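(* For every integer $k\geq 3$ and every real $0\leq\delta\leq k-2$, there is an adaptive data structure for $\textsf{kSUM-Indexing}(G,N)$ with space $S=\widetilde{O}(N^{k-1-\delta})$ and query time $T=\widetilde{O}(N^{3\delta})$.
   Context: Model: word RAM with words of $\Theta(\log N)$ bits; $G$ is an abelian group with $|G|\leq N^c$ for a constant $c>0$, equipped with an efficiently computable injective map $\mathsf{Index}:G\to[N^c]$, so each element fits in a word. The problem $\textsf{kSUM-Indexing}(G,N)$ (for an integer $N\geq k-1$) is solved by a two-part algorithm $(\mathcal{A}_1,\mathcal{A}_2)$: in the preprocessing phase, the computationally unbounded $\mathcal{A}_1$ receives a tuple $A=(a_1,\ldots,a_N)$ of elements of $G$ and outputs a data structure $D_A$ of at most $S$ words. Let $Z=\{\sum_{i\in I}a_i : I\subseteq[N],\ |I|=k-1\}$. In the query phase, given an arbitrary query $b\in Z$, $\mathcal{A}_2$ makes at most $T$ probes (queries) to cells of $D_A$ and must output $I\subseteq[N]$ with $|I|=k-1$ and $\sum_{i\in I}a_i=b$. The online computation of $\mathcal{A}_2$ is not otherwise bounded; ''adaptive'' means the probed cells may depend on earlier probe answers. $\widetilde{O}$ hides polylogarithmic factors in $N$. *)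

(* Defs.v *)
From HB Require Import structures.
From mathcomp Require Import all_boot all_order all_algebra.
From mathcomp Require Import all_classical all_reals all_analysis.

Set Implicit Arguments.
Unset Strict Implicit.
Unset Printing Implicit Defensive.

Import Order.TTheory GRing.Theory Num.Theory.
Import numFieldNormedType.Exports.

Local Open Scope classical_set_scope.
Local Open Scope ring_scope.

Definition softO (R : realType) (f g : nat -> R) : Prop :=
  exists e : nat,
    (f : nat -> R^o) =O_\oo (fun N => g N * ln (N%:R) ^+ e : R^o).

Definition word (w : nat) := w.-tuple bool.

(* The online algorithm, on a fixed query, in the cell-probe model: the next
   address and the final output depend only on the words read so far, and
   computation between probes is free. *)
Inductive probe_tree (S w : nat) (O : Type) : Type :=
| Output of O
| Probe of 'I_S & (word w -> probe_tree S w O).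

Fixpoint run (S w : nat) (O : Type) (t : probe_tree S w O)
    (D : S.-tuple (word w)) : O :=
  match t with
  | Output o => o
  | Probe i next => run (next (tnth D i)) D
  end.

Fixpoint num_probes (S w : nat) (O : Type) (t : probe_tree S w O)
    (D : S.-tuple (word w)) : nat :=
  match t with
  | Output _ => 0%N
  | Probe i next => (num_probes (next (tnth D i)) D).+1
  end.

Definition index_sum (G : finZmodType) (N : nat) (A : N.-tuple G)
  (I : {set 'I_N}) : G := \sum_(i in I) tnth A i.

Definition query_set (k : nat) (G : finZmodType) (N : nat) (A : N.-tuple G) :
    {set G} :=
  [set index_sum A I | I : {set 'I_N} & #|I| == k.-1].

(* A structure using fewer than S words is padded to exactly S. *)
Record data_structure (G : finZmodType) (N w S : nat) := DataStructure {
  preprocess : N.-tuple G -> S.-tuple (word w);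
  query : G -> probe_tree S w {set 'I_N} }.

Definition solves_kSUM_indexing (k : nat) (G : finZmodType) (N w S T : nat)
    (P : data_structure G N w S) : Prop :=
  forall (A : N.-tuple G) (b : G), b \in query_set k A ->
    let D := preprocess P A in
    let I := run (query P b) D in
    [/\ (num_probes (query P b) D <= T)%N,
        #|I| = k.-1 &
        index_sum A I = b].

(* Main.v *)
Require Import Defs.
From HB Require Import structures.
From mathcomp Require Import all_boot all_order all_algebra.
From mathcomp Require Import ring lra zify.

(** Function inversion in the style of Fiat and Naor, with lazy rainbow tables.
    Put [M = N ^ (k - 1)] and [t ~ N ^ delta], and let [f] send a [(k-1)]-tuple
    of distinct indices to the sum of the elements it selects.  At most [M / t]
    elements have more than [t] preimages; these heavy elements are stored
    explicitly with a preimage.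

    A rainbow table consists of [t] hash functions [h_1, ..., h_t] with values
    in the tuples and of about [M / (18 t^2)] chains.  At level [j] a chain
    standing at [z] moves to [f (h_j z)] if this is a light element and stays at
    [z] otherwise, so that the heavy part of the domain is avoided without
    rejection sampling.  Two chains merge at a level with probability at most
    [3 t / M] and a level hits a given light element with probability at least
    [1 / M] per chain, so a potential function shows that for some choice of
    the [h_j] the chains with distinct endpoints visit a fraction [1 / (72 t)]
    of any prescribed set of light elements.  Greedily, [O (t log M)] tables,
    each stored as its seeds and a dictionary from endpoints to chains, cover
    all light elements.  A query tries every table and every level: walk from
    [b] to the endpoint, look up the chain, and replay it from its start.

    Pairwise independence is all that the averaging uses, so a hash function is
    described by [O (log N)] group elements.  Between probes computation is
    free, hence for [t ^ 3 >= N] it is enough to read all of [A]. *)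

Set Implicit Arguments.
Unset Strict Implicit.
Unset Printing Implicit Defensive.

Import Order.TTheory GRing.Theory Num.Theory.

(** Each [tau] embeds one fiber into another, and this works in both directions, so all fibers have
    the same size and their sizes add up to [#|T|]. *)
Lemma uniform_fibers (T W : finType) (phi : T -> W) :
  (forall w w', exists2 tau : T -> T, injective tau &
     forall s, phi s = w -> phi (tau s) = w') ->
  forall w, (#|[set s | phi s == w]| * #|W| = #|T|)%N.
Proof.
move=> trans w.
have le_fib w1 w2 : #|[set s | phi s == w1]| <= #|[set s | phi s == w2]|.
  have [tau tauI tauP] := trans w1 w2.
  rewrite -(card_imset _ tauI); apply: subset_leq_card.
  by apply/subsetP=> _ /imsetP[s + ->]; rewrite !inE => /eqP/tauP ->.
have -> : #|T| = (\sum_(w' : W) #|[set s | phi s == w']|)%N.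
  rewrite -sum1_card (partition_big phi predT) //=; apply: eq_bigr => w' _.
  by rewrite -sum1_card; apply: eq_bigl => s; rewrite !inE.
rewrite (eq_bigr (fun _ => #|[set s | phi s == w]|)) ?sum_nat_const 1?mulnC //.
by move=> w' _; apply/anti_leq; rewrite !le_fib.
Qed.

(** * Pairwise independent hashing *)

Section SubsetSumHash.

Local Open Scope ring_scope.

Variables (V : finZmodType) (Z : finType) (r : nat) (code : Z -> {set 'I_r}).
Hypothesis codeI : injective code.

(** A seed is a shift together with one group element per coordinate of the code. Subset sums need
    only an abelian group, so no field structure on [V] is called for. *)
Definition hash_seed : Type := (V * {ffun 'I_r -> V})%type.
HB.instance Definition _ := Finite.on hash_seed.

Definition hash (s : hash_seed) (z : Z) : V := s.1 + \sum_(i in code z) s.2 i.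

Lemma hash_uniform (z : Z) (v : V) :
  (#|[set s | hash s z == v]| * #|V| = #|{: hash_seed}|)%N.
Proof.
apply: (uniform_fibers (phi := hash^~ z)) => w w'.
exists (fun s => (w' - w + s.1, s.2)) => [[b a] [b' a'] [/addrI -> ->] //|s <-].
by rewrite /hash /= -addrA subrK.
Qed.

Let bump_coord (i : 'I_r) (x : V) (a : {ffun 'I_r -> V}) : {ffun 'I_r -> V} :=
  [ffun j => if j == i then x + a j else a j].

Let sum_bump i x a (B : {set 'I_r}) :
  \sum_(j in B) bump_coord i x a j = (if i \in B then x else 0) + \sum_(j in B) a j.
Proof.
case: ifPn => iB.
  rewrite (bigD1 i) //= [in RHS](bigD1 i) //= ffunE eqxx addrA; congr +%R.
  by apply: eq_bigr => j /andP[_ /negPf ji]; rewrite ffunE ji.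
rewrite add0r; apply: eq_bigr => j jB; rewrite ffunE.
by case: eqP jB iB => // -> ->.
Qed.

(* For [i] in [code z] but not in [code z'], shifting [s.2 i] moves the hash of
   [z] and fixes that of [z'], while shifting [s.1] moves both. *)
Lemma hash_pairwise_uniform (z z' : Z) (v v' : V) : z != z' ->
  (#|[set s | (hash s z == v) && (hash s z' == v')]| * (#|V| * #|V|) =
   #|{: hash_seed}|)%N.
Proof.
move=> zz'.
have shift (z1 z2 : Z) (w1 w2 w1' w2' : V) i : i \in code z1 -> i \notin code z2 ->
    exists2 tau : hash_seed -> hash_seed, injective tau &
      forall s, hash s z1 = w1 -> hash s z2 = w2 ->
        hash (tau s) z1 = w1' /\ hash (tau s) z2 = w2'.
  move=> iz1 iz2.
  exists (fun s => (w2' - w2 + s.1, bump_coord i (w1' - w1 - (w2' - w2)) s.2)).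
    move=> [b a] [b' a'] [/addrI -> /ffunP eqa]; congr pair; apply/ffunP => j.
    by have := eqa j; rewrite !ffunE; case: eqP => // _ /addrI.
  move=> s <- <-; rewrite /hash /= !sum_bump iz1 (negPf iz2).
  set s1 := s.1; set x := \sum_(j in code z1) _; set y := \sum_(j in code z2) _.
  split; last by rewrite add0r -addrA subrK.
  rewrite addrACA [_ + (_ - _ - _)]addrC subrK; exact: subrK.
rewrite -card_prod.
rewrite (_ : [set s | _] = [set s | (hash s z, hash s z') == (v, v')]); last first.
  by apply/setP => s; rewrite !inE.
apply: (uniform_fibers (phi := fun s => (hash s z, hash s z'))).
move=> [w1 w2] [w1' w2'].
have [i] : exists i, (i \in code z) != (i \in code z').
  apply/existsP; rewrite -negb_forall; apply: contra zz' => /forallP eqc.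
  by apply/eqP/codeI/setP => i; exact/eqP/eqc.
case: (boolP (i \in code z)) => iz; case: (boolP (i \in code z')) => iz' // _.
  have [tau tauI tauP] := shift z z' w1 w2 w1' w2' i iz iz'.
  by exists tau => // s [/tauP tP /tP [-> ->]].
have [tau tauI tauP] := shift z' z w2 w1 w2' w1' i iz' iz.
by exists tau => // s [e /tauP /(_ e) [-> ->]].
Qed.

End SubsetSumHash.

(** * One rainbow table *)

Section Mean.

Local Open Scope ring_scope.

Variable T : finType.
Hypothesis T_gt0 : (0 < #|T|)%N.

Definition mean (F : T -> rat) : rat := (\sum_s F s) / #|T|%:R.

Definition prob (P : pred T) : rat := mean (fun s => (P s)%:R).

Let T_gt0R : 0 < #|T|%:R :> rat. Proof. by rewrite ltr0n. Qed.

Lemma le_mean (F G : T -> rat) : (forall s, F s <= G s) -> mean F <= mean G.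
Proof. by move=> FG; rewrite ler_pM2r ?invr_gt0 // ler_sum. Qed.

Lemma eq_mean (F G : T -> rat) : F =1 G -> mean F = mean G.
Proof. by move=> FG; rewrite /mean (eq_bigr _ (fun i _ => FG i)). Qed.

Lemma meanD (F G : T -> rat) : mean (fun s => F s + G s) = mean F + mean G.
Proof. by rewrite /mean big_split mulrDl. Qed.

Lemma meanZ (c : rat) (F : T -> rat) : mean (fun s => c * F s) = c * mean F.
Proof. by rewrite /mean -mulr_sumr mulrA. Qed.

Lemma mean_const (c : rat) : mean (fun _ => c) = c.
Proof.
by rewrite /mean sumr_const -[c *+ _]mulr_natr mulfK // lt0r_neq0.
Qed.

Lemma mean_sum (I : finType) (A : pred I) (F : I -> T -> rat) :
  mean (fun s => \sum_(i in A) F i s) = \sum_(i in A) mean (F i).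
Proof. by rewrite /mean exchange_big mulr_suml. Qed.

(** The passage from expectation to existence: the seed of a level is fixed to be one that does at
    least as well as the average. *)
Lemma mean_ex (F : T -> rat) : exists s, mean F <= F s.
Proof.
case: (boolP [exists s, mean F <= F s]) => [/existsP //|].
rewrite negb_exists => /forallP ltF.
have [s0 _] : exists s0 : T, true by case/card_gt0P: T_gt0 => s0; exists s0.
have : \sum_s F s < \sum_(s : T) mean F.
  by apply: ltr_sum => [|s _]; [apply/hasP; exists s0 | rewrite ltNge].
by rewrite sumr_const -[_ *+ _]mulr_natr /mean divfK ?ltxx ?lt0r_neq0.
Qed.

Lemma probE (P : pred T) : prob P = #|[set s | P s]|%:R / #|T|%:R.
Proof.
rewrite /prob /mean -sum1dep_card natr_sum [in RHS]big_mkcond; congr (_ / _).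
by apply: eq_bigr => s _; case: (P s).
Qed.

End Mean.

(** * Lazy walks and the potential function *)

Section LazyStep.

Local Open Scope ring_scope.

(** Arithmetic of one level: [a], [w], [k] count alive chains, owned elements and owned elements
    with alive owner; primes mark means after the level. The charges for [w] and [m - a] cancel the
    losses in [k']. What remains of the ideal gain [m * beta] is lessened by
    [m * beta * eps * (3 * r + 1)], which is at most half of it. *)
Lemma potential_gain (m beta eps r j k w a k' w' a' : rat) :
  k - 2 * eps * w + a * beta - m * beta * eps <= k' ->
  w' <= w + m * beta -> a - m * eps <= a' ->
  0 <= m -> 0 <= beta -> 0 <= eps -> 0 <= r ->
  3 * eps * (r + 1) <= 1 / 2 ->
  j * (m * beta / 2) <= k - 2 * eps * (r + 1) * w - beta * (r + 1) * (m - a) ->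
  (j + 1) * (m * beta / 2) <=
    k' + (- (2 * eps * r)) * w' + (- (beta * r * m) + (beta * r) * a').
Proof.
move=> Hk Hw Ha m0 b0 e0 r0 small Hj.
have er0 : 0 <= 2 * eps * r by rewrite !mulr_ge0.
have br0 : 0 <= beta * r by rewrite mulr_ge0.
have mb0 : 0 <= m * beta by rewrite mulr_ge0.
have Hw' := ler_wpM2l er0 Hw; have Ha' := ler_wpM2l br0 Ha.
have small' := ler_wpM2l mb0 small.
have mbe0 : 0 <= m * beta * eps by rewrite !mulr_ge0.
lra.
Qed.

Variables (Seed Y : finType) (m : nat).
Variables (hit : Seed -> 'I_m + Y -> option Y) (p : Y -> rat) (tau : rat).
Hypothesis Seed_gt0 : (0 < #|Seed|)%N.
Hypothesis p_ge0 : forall u, 0 <= p u.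
Hypothesis p_le : forall u, p u <= tau.
Hypothesis sum_p : \sum_u p u <= 1.
Hypothesis prob_hit : forall z u, prob (fun s => hit s z == Some u) = p u.
Hypothesis prob_hit2 : forall z z' u, z != z' ->
  prob (fun s => (hit s z == Some u) && (hit s z' == Some u)) = p u * p u.
Hypothesis tau_ge0 : 0 <= tau.

(** The position [inl i] is an artificial start for chain [i], so the starts are distinct for free
    and never coincide with a value. *)
Definition step (s : Seed) (z : 'I_m + Y) : 'I_m + Y :=
  if hit s z is Some u then inr u else z.

(** The chance that a given chain merges at a level, by a union bound over at most [m] rivals. *)
Let eps : rat := 3 * m%:R * tau.

Let eps_ge0 : 0 <= eps.
Proof. by rewrite !mulr_ge0. Qed.

Let occupied (z : 'I_m + Y) (s : Seed) (z' : 'I_m + Y) : rat :=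
  if z' is inr u then (hit s z == Some u)%:R else 0.

Let mean_occupied z z' : mean (fun s => occupied z s z') <= tau.
Proof.
case: z' => [i|u]; first by rewrite (@mean_const _ Seed_gt0).
by apply: le_trans (p_le u); rewrite -(prob_hit z).
Qed.

(** Distinct positions can meet in three ways: both hit the same [u], or one of them hits the place
    where the other one stays. Each way has probability at most [tau], the first because the sum of
    [p u * p u] is at most [tau * \sum_u p u]. *)
Lemma prob_merge z z' : z != z' ->
  prob (fun s => step s z == step s z') <= 3 * tau.
Proof.
move=> zz'.
apply: (@le_trans _ _ (mean (fun s =>
    (\sum_(u in predT) ((hit s z == Some u) && (hit s z' == Some u))%:R) +
    (occupied z s z' + occupied z' s z)))).
  apply: le_mean => // s; set both := \sum_(u in _) _.
  have both0 : 0 <= both by exact: sumr_ge0.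
  have occ0 x x' : 0 <= occupied x s x' by rewrite /occupied; case: x'.
  case: eqP => [e|_]; last by rewrite !addr_ge0.
  move: e; rewrite /step; case hz: (hit s z) => [u|]; case hz': (hit s z') => [u'|] e.
  - rewrite /both (bigD1 u) //= -addrA hz hz'; case: e => ->.
    by rewrite eqxx lerDl !addr_ge0 // sumr_ge0.
  - by rewrite addrCA -e {1}/occupied hz eqxx lerDl addr_ge0.
  - by rewrite addrA e {2}/occupied hz' eqxx lerDr addr_ge0.
  - by rewrite e eqxx in zz'.
rewrite 2!meanD mean_sum.
have -> : \sum_(u in predT) mean (fun s => ((hit s z == Some u) && (hit s z' == Some u))%:R)
  = \sum_u p u * p u by apply: eq_bigr => u _; exact: prob_hit2.
have : \sum_u p u * p u <= tau.
  apply: (@le_trans _ _ (\sum_u tau * p u)).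
    by apply: ler_sum => u _; rewrite ler_wpM2r.
  by rewrite -mulr_sumr -[leRHS]mulr1 ler_wpM2l.
have := mean_occupied z z'; have := mean_occupied z' z; lra.
Qed.

Section OneLevel.

Variables (U : {set Y}) (Al : {set 'I_m}) (pos : 'I_m -> 'I_m + Y).
Variable own : Y -> option 'I_m.
Hypothesis pos_inj : {in Al &, injective pos}.
Hypothesis pos_own : forall i u, i \in Al -> u \in U -> pos i = inr u -> own u != None.
Hypothesis eps_le1 : eps <= 1.

(** Both partners of a merge die, so survival is symmetric and the survivors stand at distinct
    positions. *)
Definition alive_next (s : Seed) : {set 'I_m} :=
  [set i in Al | [forall j in Al, (j != i) ==> (step s (pos j) != step s (pos i))]].

(* [own u] is the chain that hit [u] first, at a time when it was alive. *)
Definition own_next (s : Seed) (u : Y) : option 'I_m :=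
  if own u is Some i then Some i
  else if u \in U then [pick i in Al | hit s (pos i) == Some u] else None.

Definition owned_alive (A : {set 'I_m}) (o : Y -> option 'I_m) : {set Y} :=
  [set u | if o u is Some i then i \in A else false].

Definition owned (o : Y -> option 'I_m) : {set Y} := [set u | o u != None].

Let beta : rat := \sum_(u in U) p u.

Let beta_ge0 : 0 <= beta. Proof. by rewrite sumr_ge0. Qed.

Let card_Al : #|Al|%:R <= m%:R :> rat.
Proof. by rewrite ler_nat -[X in (_ <= X)%N]card_ord max_card. Qed.

Let death s i : i \in Al ->
  (i \notin alive_next s)%:R <=
  \sum_(j in Al :\ i) (step s (pos i) == step s (pos j))%:R :> rat.
Proof.
move=> iAl; rewrite inE iAl /=; case: forallP => [|/forallP]; first by rewrite sumr_ge0.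
rewrite negb_forall => /existsP[j]; rewrite negb_imply => /andP[jAl].
rewrite negb_imply negbK => /andP[ji e].
rewrite (bigD1 j) ?in_setD1 ?ji //= eq_sym e lerDl sumr_ge0 //.
Qed.

Lemma prob_death i : i \in Al -> prob (fun s => i \notin alive_next s) <= eps.
Proof.
move=> iAl; apply: (le_trans (le_mean _ (fun s => death s iAl))) => //.
rewrite mean_sum.
apply: (@le_trans _ _ (\sum_(j in Al :\ i) 3 * tau)).
  apply: ler_sum => j; rewrite in_setD1 => /andP[ji jAl]; apply: prob_merge.
  by apply: contra ji => /eqP/pos_inj -> //.
rewrite sumr_const -[_ *+ #|_|]mulr_natr /eps [leRHS]mulrAC ler_wpM2l ?mulr_ge0 //.
apply: le_trans card_Al; rewrite ler_nat; exact/subset_leq_card/subD1set.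
Qed.

(** If chain [i] hits [u] and dies, some alive [j] also moved to [u]: by [pos_own] no alive chain
    was already standing at the unowned [u]. Pairwise independence bounds each such double hit by
    [p u * tau], so the loss keeps the factor [p u]. *)
Lemma prob_hit_alive i u : i \in Al -> u \in U -> own u = None ->
  p u * (1 - eps) <= prob (fun s => (hit s (pos i) == Some u) && (i \in alive_next s)).
Proof.
move=> iAl uU uo.
have -> : prob (fun s => (hit s (pos i) == Some u) && (i \in alive_next s)) =
   p u - prob (fun s => (hit s (pos i) == Some u) && (i \notin alive_next s)).
  rewrite -(prob_hit (pos i)) /prob; apply/eqP; rewrite eq_sym subr_eq -meanD.
  apply/eqP/eq_mean => s; case: (_ == _) => //=; rewrite ?addr0 //.
  by case: (i \in _); rewrite ?addr0 ?add0r.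
rewrite mulrBr mulr1 lerD2l lerN2.
apply: (@le_trans _ _ (mean (fun s => \sum_(j in Al :\ i)
     ((hit s (pos i) == Some u) && (hit s (pos j) == Some u))%:R))).
  apply: le_mean => // s; case: eqP => [hu|_] /=; last by rewrite sumr_ge0.
  apply: (le_trans (death s iAl)); apply: ler_sum => j.
  rewrite in_setD1 => /andP[ji jAl]; rewrite ler_nat /step hu.
  case hj : (hit s (pos j)) => [u'|].
    by case: eqP => [[->]|//]; rewrite eqxx.
  case: eqP => // e; have := pos_own jAl uU (esym e); by rewrite uo.
rewrite mean_sum.
apply: (@le_trans _ _ (\sum_(j in Al :\ i) p u * tau)).
  apply: ler_sum => j; rewrite in_setD1 => /andP[ji jAl].
  rewrite [X in X <= _]prob_hit2 ?ler_wpM2l //.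
  by apply: contra ji => /eqP/pos_inj -> //.
rewrite sumr_const -[_ *+ #|_|]mulr_natr -mulrA ler_wpM2l // /eps.
have : #|Al :\ i|%:R <= m%:R :> rat.
  apply: le_trans card_Al; rewrite ler_nat; exact/subset_leq_card/subD1set.
move=> /(ler_wpM2l tau_ge0); have : 0 <= tau * m%:R by rewrite mulr_ge0.
lra.
Qed.

Let indic_setE (A : {set Y}) : #|A|%:R = \sum_u (u \in A)%:R :> rat.
Proof. by rewrite -sum1_card natr_sum big_mkcond; apply: eq_bigr => u _; case: ifP. Qed.

Lemma mean_alive : #|Al|%:R - m%:R * eps <= mean (fun s => #|alive_next s|%:R).
Proof.
have -> : mean (fun s => #|alive_next s|%:R) =
    mean (fun s => #|Al|%:R + (-1) * \sum_(i in Al) (i \notin alive_next s)%:R).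
  apply: eq_mean => s; rewrite mulN1r -[in X in X - _]sum1_card natr_sum -sumrB.
  rewrite -sum1_card natr_sum big_mkcond [RHS]big_mkcond; apply: eq_bigr => i _.
  case: ifPn => [|iN]; first by rewrite inE => /andP[-> _]; rewrite subr0.
  by case: ifP => //; rewrite subrr.
rewrite meanD mean_const // meanZ mean_sum mulN1r lerD2l lerN2.
apply: (@le_trans _ _ (\sum_(i in Al) eps)); first exact: ler_sum prob_death.
by rewrite sumr_const -[_ *+ #|_|]mulr_natl ler_wpM2r.
Qed.

Lemma mean_owned :
  mean (fun s => #|owned (own_next s)|%:R) <= #|owned own|%:R + m%:R * beta.
Proof.
apply: (@le_trans _ _ (mean (fun s => #|owned own|%:R +
   \sum_(u in U) \sum_(i in Al) (hit s (pos i) == Some u)%:R))).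
  apply: le_mean => // s; rewrite !indic_setE [X in _ <= _ + X]big_mkcond -big_split.
  apply: ler_sum => u _ /=; rewrite !inE /own_next.
  case: (own u) => [i|] /=.
    by rewrite lerDl; case: ifP => // _; rewrite sumr_ge0.
  rewrite add0r; case: ifP => //= _; case: pickP => [i /andP[iAl e]|_] /=.
    by rewrite (bigD1 i) //= e lerDl sumr_ge0.
  by rewrite sumr_ge0.
rewrite meanD mean_const // lerD2l mean_sum.
rewrite mulr_sumr; apply: ler_sum => u _; rewrite mean_sum.
rewrite (eq_bigr (fun=> p u)) => [|i _]; last exact: prob_hit.
by rewrite sumr_const -[_ *+ #|_|]mulr_natl ler_wpM2r.
Qed.

(** Old owners die with probability at most [eps] each, which costs [eps] times the number of owned
    elements. New elements come from hits by surviving chains; hits wasted on owned elements cost at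
    most [m * tau], a third of [eps], per owned element. *)
Lemma mean_owned_alive :
  #|owned_alive Al own|%:R - 2 * eps * #|owned own|%:R + #|Al|%:R * beta
    - m%:R * beta * eps <=
  mean (fun s => #|owned_alive (alive_next s) (own_next s)|%:R).
Proof.
apply: (@le_trans _ _ (mean (fun s =>
   (\sum_(u in owned_alive Al own)
      (1 + (-1) * (if own u is Some i then (i \notin alive_next s)%:R else 0)))
   + \sum_(u in U :\: owned own) \sum_(i in Al)
      ((hit s (pos i) == Some u) && (i \in alive_next s))%:R))); last first.
  apply: le_mean => // s; rewrite indic_setE big_mkcond [X in _ + X]big_mkcond -big_split.
  apply: ler_sum => u _ /=; rewrite !inE /own_next mulN1r.
  case o: (own u) => [i|] /=.
    rewrite addr0; case: ifP => // iAl.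
    by case: (i \in alive_next s); rewrite ?subr0 ?subrr.
  rewrite add0r; case: ifP => //= uU.
  (* A surviving chain that hits [u] is the only alive chain to do so; hence at most one summand is
     nonzero, and the owner picked for [u] is this chain. *)
  have [i /andP[iAl' hi]|none] := pickP [pred i in alive_next s | hit s (pos i) == Some u];
    last first.
    by rewrite big1 // => i iAl; move: (none i); rewrite /= andbC; case: (_ && _).
  have iAl : i \in Al by move: iAl'; rewrite inE => /andP[].
  rewrite (bigD1 i) //= hi iAl' big1 ?addr0 => [|j /andP[jAl ji]]; last first.
    move: iAl'; rewrite inE => /andP[_ /forallP/(_ j)]; rewrite jAl ji /=.
    by rewrite /step (eqP hi); case: (hit s (pos j) =P Some u) => // ->; rewrite eqxx.
  case: pickP => [j /andP[jAl hj]|/(_ i)]; last by rewrite /= iAl hi.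
  case: (eqVneq j i) => [->|ji]; first by rewrite iAl'.
  move: iAl'; rewrite inE => /andP[_ /forallP/(_ j)]; rewrite jAl ji /=.
  by rewrite /step (eqP hi) (eqP hj) eqxx.
rewrite meanD mean_sum mean_sum.
have le1 : #|owned_alive Al own|%:R - eps * #|owned own|%:R <= \sum_(u in owned_alive Al own)
  mean (fun s => 1 + (-1) * (if own u is Some i then (i \notin alive_next s)%:R else 0)).
  apply: (@le_trans _ _ (\sum_(u in owned_alive Al own) (1 - eps))).
    rewrite sumr_const -[leRHS]mulr_natr mulrBl mul1r lerD2l lerN2 ler_wpM2l // ler_nat.
    apply: subset_leq_card; apply/subsetP => u; rewrite !inE; by case: (own u).
  apply: ler_sum => u; rewrite inE meanD mean_const // meanZ mulN1r.
  case: (own u) => // i iAl; rewrite lerD2l lerN2; exact: prob_death.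
(* Leaving out the owned elements lowers the mass [beta] by at most [tau] for each of them. *)
have le2 : #|Al|%:R * (beta - tau * #|owned own|%:R) * (1 - eps)
  <= \sum_(u in U :\: owned own)
   mean (fun s => \sum_(i in Al) ((hit s (pos i) == Some u) && (i \in alive_next s))%:R).
  apply: (@le_trans _ _ (\sum_(u in U :\: owned own) #|Al|%:R * p u * (1 - eps))).
    rewrite -mulr_suml -mulr_sumr ler_wpM2r ?subr_ge0 // ler_wpM2l //.
    rewrite lerBlDr /beta (bigID (fun u => u \in owned own)) /= addrC lerD //.
      rewrite le_eqVlt; apply/orP; left; apply/eqP/eq_bigl => u.
      by rewrite in_setD andbC.
    apply: (@le_trans _ _ (\sum_(u in owned own) p u)).
      rewrite [leLHS]big_mkcondl; apply: ler_sum => u _; by case: ifP.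
    apply: (@le_trans _ _ (\sum_(u in owned own) tau)); first exact: ler_sum.
    by rewrite sumr_const -[_ *+ #|_|]mulr_natr.
  apply: ler_sum => u; rewrite !inE negbK => /andP[/eqP uo uU]; rewrite mean_sum.
  apply: (@le_trans _ _ (\sum_(i in Al) p u * (1 - eps))).
    by rewrite sumr_const -[leRHS]mulr_natl mulrA.
  by apply: ler_sum => i iAl; exact: prob_hit_alive.
apply: le_trans (lerD le1 le2).
move: card_Al eps_ge0 eps_le1 beta_ge0; rewrite /eps.
set a := #|Al|%:R; set W := #|owned own|%:R; set K := #|owned_alive _ _|%:R.
have W0 : 0 <= W by exact: ler0n. have a0 : 0 <= a by exact: ler0n.
rewrite -/eps => am e0 e1 b0.
have h1 : a * beta * eps <= m%:R * beta * eps by rewrite ler_wpM2r // ler_wpM2r.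
have h2 : a * tau * W <= m%:R * tau * W by rewrite ler_wpM2r // ler_wpM2r.
have h3 : 3 * (m%:R * tau * W) = eps * W by rewrite /eps; ring.
have h4 : 0 <= m%:R * tau * W by rewrite !mulr_ge0.
have h5 : 0 <= a * tau * W * eps by rewrite !mulr_ge0.
have -> : a * (beta - tau * W) * (1 - eps) =
  a * beta - a * beta * eps - a * tau * W + a * tau * W * eps by ring.
lra.
Qed.

End OneLevel.

Definition walk (ss : seq Seed) (z : 'I_m + Y) : 'I_m + Y :=
  foldl (fun z s => step s z) z ss.

Definition chain_hits (ss : seq Seed) (i : 'I_m) (u : Y) : Prop :=
  exists s1 s s2, ss = s1 ++ s :: s2 /\ hit s (walk s1 (inl i)) = Some u.

(** The first two clauses are the hypotheses [pos_inj] and [pos_own] for the next level; the last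
    one ties ownership to actual visits. *)
Definition table_inv (U : {set Y}) (ss : seq Seed) (Al : {set 'I_m})
    (own : Y -> option 'I_m) : Prop :=
  [/\ {in Al &, injective (fun i => walk ss (inl i))},
      forall i u, i \in Al -> u \in U -> walk ss (inl i) = inr u -> own u != None &
      forall u i, own u = Some i -> u \in U /\ chain_hits ss i u].

Lemma table_inv_next (U : {set Y}) ss Al own s : table_inv U ss Al own ->
  let pos i := walk ss (inl i) in
  table_inv U (rcons ss s) (alive_next Al pos s) (own_next U Al pos own s).
Proof.
case=> injA posA ownA pos; have walkE i : walk (rcons ss s) (inl i) = step s (pos i).
  by rewrite /walk foldl_rcons.
have sub i : i \in alive_next Al pos s -> i \in Al by rewrite inE => /andP[].
split=> [i j iA jA|i u iA uU|u i].
- rewrite !walkE => e; apply/eqP; apply: contraTT iA => ij; rewrite inE negb_and.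
  apply/orP; right; rewrite negb_forall; apply/existsP; exists j.
  by rewrite (sub _ jA) eq_sym ij e eqxx.
- rewrite walkE /step /own_next uU; case hi: (hit s (pos i)) => [u'|] e.
    case: e hi => -> hi; case: (own u) => //; case: pickP => // /(_ i).
    by rewrite /= (sub _ iA) hi eqxx.
  by have := posA i u (sub _ iA) uU e; case: (own u).
rewrite /own_next; case o: (own u) => [j|].
  case=> <-; have [uU [s1 [s' [s2 [-> h]]]]] := ownA _ _ o; split=> //.
  by exists s1, s', (rcons s2 s); rewrite rcons_cat.
case: ifP => // uU; case: pickP => // j /andP[_ /eqP hj] [<-]; split=> //.
by exists ss, s, [::]; rewrite cats1.
Qed.

(** The seeds are chosen level by level, each raising the potential by at least [m * beta / 2]. With
    no level left the potential is just the number of elements whose owner is alive, and these form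
    [C]. *)
Lemma table_exists (U : {set Y}) (t : nat) : 3 * eps * t%:R <= 1 / 2 -> (0 < t)%N ->
  exists ss : seq Seed, exists Al : {set 'I_m}, exists C : {set Y},
  [/\ size ss = t, {in Al &, injective (fun i => walk ss (inl i))},
      C \subset U,
      t%:R * m%:R * (\sum_(u in U) p u) / 2 <= #|C|%:R &
      forall u, u \in C -> exists2 i, i \in Al & chain_hits ss i u].
Proof.
move=> small t0; set beta := \sum_(u in U) p u.
have beta0 : 0 <= beta by rewrite sumr_ge0.
have eps1 : eps <= 1.
  have : 1 <= t%:R :> rat by rewrite ler1n.
  by move/(ler_wpM2l eps_ge0); lra.
(* [r] levels remain: each may kill owners, waste hits on owned elements and
   lose the hits of dead chains; [Psi] charges the expected losses in advance. *)
pose Psi (r : nat) (Al : {set 'I_m}) (own : Y -> option 'I_m) : rat :=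
  #|owned_alive Al own|%:R - 2 * eps * r%:R * #|owned own|%:R
    - beta * r%:R * (m%:R - #|Al|%:R).
have build j : (j <= t)%N -> exists ss, exists Al, exists own,
   [/\ size ss = j, table_inv U ss Al own & j%:R * (m%:R * beta / 2) <= Psi (t - j)%N Al own].
  elim: j => [_|j IH jt].
    exists [::], [set: 'I_m], (fun _ => None); split=> //.
      by split=> [i i' _ _ []|i u _ _|u i].
    have kE : #|owned_alive [set: 'I_m] (fun=> None)| = 0%N by apply: eq_card0 => u; rewrite inE.
    by rewrite /Psi kE cardsT card_ord subrr mul0r !mulr0 !subr0.
  have [ss [Al [own [sz inv le]]]] := IH (ltnW jt).
  pose pos i := walk ss (inl i).
  pose Al' := alive_next Al pos; pose own' := own_next U Al pos own.
  have [injA posA _] := inv.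
  have [s les] := mean_ex Seed_gt0 (fun s => Psi (t - j.+1)%N (Al' s) (own' s)).
  exists (rcons ss s), (Al' s), (own' s); split; rewrite ?size_rcons ?sz //.
    exact: table_inv_next.
  apply: le_trans les.
  set r := (t - j.+1)%N.
  have tjE : (t - j)%N = r.+1 by rewrite /r subnSK.
  have -> : mean (fun s => Psi r (Al' s) (own' s)) =
     mean (fun s => #|owned_alive (Al' s) (own' s)|%:R)
     + (- (2 * eps * r%:R)) * mean (fun s => #|owned (own' s)|%:R)
     + (- (beta * r%:R * m%:R) + (beta * r%:R) * mean (fun s => #|Al' s|%:R)).
    rewrite -!meanZ -[X in _ + (X + _)](mean_const Seed_gt0) -!meanD.
    by apply: eq_mean => s'; rewrite /Psi; ring.
  have H1 := mean_owned_alive injA posA eps1.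
  have H2 := mean_owned U Al pos own.
  have H3 := mean_alive injA.
  rewrite -natr1; apply: potential_gain H1 H2 H3 _ _ _ _ _ _ => //.
    apply: le_trans small; rewrite ler_wpM2l ?mulr_ge0 //.
    by rewrite natr1 ler_nat /r subnSK // leq_subr.
  by move: le; rewrite tjE /Psi -(natr1 r).
have [ss [Al [own [sz [injA _ ownA] le]]]] := build t (leqnn t).
exists ss, Al, (owned_alive Al own); split=> //.
- apply/subsetP => u; rewrite inE; case o: (own u) => [i|] // _.
  by have [] := ownA _ _ o.
- by move: le; rewrite subnn /Psi !mulr0 !mul0r !subr0 !mulrA.
move=> u; rewrite inE; case o: (own u) => [i|] // iAl; exists i => //.
by have [] := ownA _ _ o.
Qed.

End LazyStep.

(** * Covering all light elements *)

Lemma sum_card_fibers (V Y : finType) (f : V -> option Y) :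
  \sum_u #|[set v | f v == Some u]| <= #|V|.
Proof.
rewrite (eq_bigr (fun u => \sum_v (f v == Some u))) => [|u _]; last first.
  by rewrite -sum1dep_card big_mkcond; apply: eq_bigr => v _; case: (_ == _).
rewrite exchange_big -sum1_card; apply: leq_sum => v _.
case fv: (f v) => [u|]; last by rewrite big1.
rewrite (bigD1 u) //= eqxx big1 // => u' /negPf neq.
by apply/eqP; rewrite eqb0 (inj_eq Some_inj) eq_sym neq.
Qed.

Section GreedyCover.

Variables (T : eqType) (Y : finType) (D : {set Y}) (ok : T -> Prop).
Variables (covers : T -> Y -> Prop) (q : nat).
Hypothesis cover_fraction : forall U : {set Y}, U \subset D ->
  exists x, exists C : {set Y}, [/\ ok x, C \subset U, #|U| <= q * #|C| &
    forall u, u \in C -> covers x u].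

Definition covers_but (xs : seq T) (U R : {set Y}) : Prop :=
  [/\ {in xs, forall x, ok x}, R \subset U &
      forall u, u \in U -> u \notin R -> exists2 x, x \in xs & covers x u].

(** While more than half of [U] is uncovered, every new [x] covers at least [#|R| / q], hence more
    than [#|U| / (2 * q)], further elements. *)
Lemma greedy_steps (U : {set Y}) j : U \subset D ->
  exists xs R, [/\ size xs = j, covers_but xs U R &
    2 * #|R| <= #|U| \/ j * #|U| <= 2 * q * (#|U| - #|R|)].
Proof.
move=> UD; elim: j => [|j [xs [R [sz [okx RU cov] dich]]]].
  exists [::], U; split=> //; last by right.
  by split=> // u ->.
have [x [C [okx' CR le covC]]] := cover_fraction (subset_trans RU UD).
exists (x :: xs), (R :\: C); split; rewrite /= ?sz //.
  split=> [y|| u uU].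
  - by rewrite in_cons => /orP[/eqP ->|/okx].
  - exact: subset_trans (subsetDl _ _) RU.
  - rewrite in_setD negb_and negbK; case: (boolP (u \in C)) => [uC _|_ /= uR].
      by exists x; rewrite ?mem_head //; exact: covC.
    by have [y yx cy] := cov u uU uR; exists y; rewrite // in_cons yx orbT.
have cRC : #|R :\: C| = #|R| - #|C| by rewrite cardsD (setIidPr CR).
have leCR := subset_leq_card CR; have leRU := subset_leq_card RU.
case: dich => [half|le2]; first by left; lia.
case: (leqP (2 * #|R :\: C|) #|U|) => [|gt]; first by left.
by right; rewrite cRC in gt *; nia.
Qed.

Lemma greedy_halvings (U : {set Y}) n : U \subset D ->
  exists xs R, [/\ size xs = q * n, covers_but xs U R & 2 ^ n * #|R| <= #|U|].
Proof.
move=> UD; elim: n => [|n [xs [R [sz [okx RU cov] le]]]].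
  exists [::], U; split; rewrite ?muln0 ?expn0 ?mul1n //.
  by split=> // u ->.
have [xs' [R' [sz' [okx' RR cov'] dich]]] := greedy_steps q (subset_trans RU UD).
have leRR := subset_leq_card RR.
exists (xs ++ xs'), R'; split; first by rewrite size_cat sz sz' mulnS addnC.
  split=> [x|| u uU uR'].
  - by rewrite mem_cat => /orP[/okx|/okx'].
  - exact: subset_trans RU.
  - case: (boolP (u \in R)) => uR.
      by have [x xx cx] := cov' u uR uR'; exists x; rewrite // mem_cat xx orbT.
    by have [x xx cx] := cov u uU uR; exists x; rewrite // mem_cat xx.
have half : 2 * #|R'| <= #|R|.
  (* After [q] steps the second alternative implies the first by cancelling [q]; for [q = 0] the
     covering hypothesis forces [R] to be empty. *)
  case: dich => // le'; case: (posnP q) => [q0|qpos]; last by nia.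
  have [x [C [_ _]]] := cover_fraction (subset_trans RU UD).
  by rewrite q0 mul0n leqn0 => /eqP ? _; lia.
by rewrite expnSr -mulnA; apply: leq_trans le; rewrite leq_mul2l half orbT.
Qed.

Lemma greedy_cover n : #|D| < 2 ^ n ->
  exists xs, [/\ size xs = q * n, {in xs, forall x, ok x} &
    forall u, u \in D -> exists2 x, x \in xs & covers x u].
Proof.
move=> lt; have [xs [R [sz [okx _ cov] le]]] := greedy_halvings n (subxx D).
exists xs; split=> // u uD; apply: cov => //; apply/negP => uR.
have : 0 < #|R| by rewrite card_gt0; apply/set0Pn; exists u.
by move: le lt; case: #|R| => // c; rewrite mulnS => le lt; lia.
Qed.

End GreedyCover.

(** * Rainbow tables with subset-sum seeds *)

Section Rainbow.

Local Open Scope ring_scope.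

Variables (V : finZmodType) (Y : finType) (m r t q : nat) (g : V -> option Y).
Variable code : 'I_m + Y -> {set 'I_r}.
Hypothesis codeI : injective code.
Hypothesis light : forall u, (#|[set v | g v == Some u]| <= t)%N.
Hypothesis t_gt0 : (0 < t)%N.
Hypothesis m_small : (18 * m * t ^ 2 <= #|V|)%N.
Hypothesis m_large : (2 * #|V| <= q * t * m)%N.

Local Notation seed := (hash_seed V r).

Definition hit (s : seed) (z : 'I_m + Y) : option Y := g (hash code s z).

Let p (u : Y) : rat := #|[set v | g v == Some u]|%:R / #|V|%:R.

Let V_gt0 : 0 < #|V|%:R :> rat.
Proof. by rewrite ltr0n; apply/card_gt0P; exists 0. Qed.

Let seed_gt0 : (0 < #|{: seed}|)%N.
Proof. by apply/card_gt0P; exists (0, [ffun=> 0]). Qed.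

Let prob_hash z v : prob (fun s : seed => hash code s z == v) = #|V|%:R^-1.
Proof.
rewrite probE -(hash_uniform code z v) natrM invfM mulrA divff ?mul1r //.
rewrite pnatr_eq0; apply: contraTneq seed_gt0.
by rewrite -(hash_uniform code z v) => ->.
Qed.

Let prob_hash2 z z' v v' : z != z' ->
  prob (fun s : seed => (hash code s z == v) && (hash code s z' == v')) = #|V|%:R^-1 ^+ 2.
Proof.
move=> zz'; rewrite probE -(hash_pairwise_uniform codeI v v' zz') natrM invfM mulrA divff.
  by rewrite mul1r natrM invfM.
rewrite pnatr_eq0; apply: contraTneq seed_gt0.
by rewrite -(hash_pairwise_uniform codeI v v' zz') => ->.
Qed.

Let indic_fiber (u : Y) (x : V) :
  (g x == Some u)%:R = \sum_(v in [set v | g v == Some u]) (x == v)%:R :> rat.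
Proof.
case: (boolP (g x == Some u)) => gx.
  rewrite (bigD1 x) ?inE //= eqxx big1 ?addr0 // => v /andP[_].
  by rewrite eq_sym => /negPf ->.
rewrite big1 // => v; rewrite inE => gv; case: eqP => // xv.
by rewrite -xv (negPf gx) in gv.
Qed.

Let prob_hit z u : prob (fun s => hit s z == Some u) = p u.
Proof.
rewrite /prob (eq_mean (fun s => indic_fiber u (hash code s z))) mean_sum.
rewrite (eq_bigr (fun=> #|V|%:R^-1)) => [|v _]; last exact: prob_hash.
by rewrite sumr_const -[LHS]mulr_natl.
Qed.

Let prob_hit2 z z' u : z != z' ->
  prob (fun s => (hit s z == Some u) && (hit s z' == Some u)) = p u * p u.
Proof.
move=> zz'; rewrite /prob.
rewrite (eq_mean (G := fun s => \sum_(v in [set v | g v == Some u])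
   \sum_(v' in [set v | g v == Some u])
     ((hash code s z == v) && (hash code s z' == v'))%:R)); last first.
  move=> s; rewrite -mulnb natrM 2!indic_fiber mulr_suml; apply: eq_bigr => v _.
  by rewrite mulr_sumr; apply: eq_bigr => v' _; rewrite -natrM mulnb.
rewrite mean_sum (eq_bigr (fun=> #|[set v | g v == Some u]|%:R * #|V|%:R^-1 ^+ 2)).
  by rewrite sumr_const -[LHS]mulr_natl /p; ring.
move=> v _; rewrite mean_sum (eq_bigr (fun=> #|V|%:R^-1 ^+ 2)).
  by rewrite sumr_const -[LHS]mulr_natl.
by move=> v' _; exact: prob_hash2.
Qed.

Let p_ge0 u : 0 <= p u. Proof. by rewrite divr_ge0. Qed.

Let p_le u : p u <= t%:R / #|V|%:R.
Proof. by rewrite ler_wpM2r ?invr_ge0 // ler_nat. Qed.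

Let sum_p : \sum_u p u <= 1.
Proof.
rewrite -mulr_suml ler_pdivrMr // mul1r -natr_sum ler_nat.
exact: sum_card_fibers.
Qed.

(** Every element of [U] has a preimage, so a hash value falls into [U] with probability at least
    [#|U| / #|V|]. One table then covers [t * m / (2 * #|V|)] of [U], and [m_large] says that this
    is at least [1 / q]. *)
Lemma rainbow_cover_fraction (U : {set Y}) :
  U \subset [set u | [exists v, g v == Some u]] ->
  exists tb : seq seed * {set 'I_m}, exists C : {set Y},
  [/\ size tb.1 = t /\ {in tb.2 &, injective (fun i => walk hit tb.1 (inl i))},
      C \subset U, (#|U| <= q * #|C|)%N &
      forall u, u \in C -> exists2 i, i \in tb.2 & chain_hits hit tb.1 i u].
Proof.
move=> /subsetP Uim.
(* With [tau = t / #|V|], the smallness condition of [table_exists] is exactly [m_small]. *)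
have small : 3 * (3 * m%:R * (t%:R / #|V|%:R)) * t%:R <= 1 / 2 :> rat.
  have -> : 3 * (3 * m%:R * (t%:R / #|V|%:R)) * t%:R =
     ((18 * m * t ^ 2)%N%:R / #|V|%:R) / 2 :> rat.
    by rewrite !natrM; field; rewrite ?lt0r_neq0.
  by rewrite ler_wpM2r // ler_pdivrMr // mul1r ler_nat.
have tau0 : 0 <= t%:R / #|V|%:R :> rat by rewrite divr_ge0.
have [ss [Al [C [sz inj CU le cov]]]] :=
  table_exists seed_gt0 p_ge0 p_le sum_p prob_hit prob_hit2 tau0 U small t_gt0.
exists (ss, Al), C; split=> //.
have : #|U|%:R / #|V|%:R <= \sum_(u in U) p u.
  have -> : #|U|%:R / #|V|%:R = \sum_(u in U) #|V|%:R^-1 :> rat.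
    by rewrite sumr_const -[RHS]mulr_natl.
  apply: ler_sum => u /Uim; rewrite inE => /existsP[v gv].
  rewrite -[leLHS]mul1r ler_wpM2r ?invr_ge0 // ler1n.
  by apply/card_gt0P; exists v; rewrite inE.
move: le; set beta := \sum_(u in U) _ => le le_beta; rewrite -(ler_nat rat) natrM.
have mlarge : 2 * #|V|%:R <= q%:R * t%:R * m%:R :> rat by rewrite -!natrM ler_nat.
move: le; rewrite ler_pdivrMr // => le.
have {}le := ler_wpM2l (ler0n rat q) le.
have le1 : 2 * #|V|%:R * (#|U|%:R / #|V|%:R) <= q%:R * t%:R * m%:R * beta.
  by apply: ler_pM => //; [exact: mulr_ge0 | exact: divr_ge0].
have e : 2 * #|V|%:R * (#|U|%:R / #|V|%:R) = 2 * #|U|%:R :> rat.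
  by field; rewrite lt0r_neq0.
rewrite e in le1; move: le le1; rewrite !mulrA => le le1; lra.
Qed.

Lemma rainbow_cover n : (#|V| < 2 ^ n)%N ->
  exists tbs : seq (seq seed * {set 'I_m}),
  [/\ size tbs = (q * n)%N,
      forall tb, tb \in tbs -> size tb.1 = t /\
         {in tb.2 &, injective (fun i => walk hit tb.1 (inl i))} &
      forall v u, g v = Some u -> exists2 tb, tb \in tbs &
        exists2 i, i \in tb.2 & chain_hits hit tb.1 i u].
Proof.
move=> lt; have ltD : (#|[set u | [exists v, g v == Some u]]| < 2 ^ n)%N.
  apply: leq_ltn_trans lt; have SomeI : injective (@Some Y) by move=> ? ? [].
  rewrite -(card_imset _ SomeI) -[X in (_ <= X)%N]cardsT.
  apply: leq_trans (leq_imset_card g _); apply: subset_leq_card.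
  apply/subsetP => _ /imsetP[u + ->]; rewrite inE => /existsP[v /eqP <-].
  by rewrite imset_f.
have [tbs [sz ok cov]] := greedy_cover rainbow_cover_fraction ltD.
exists tbs; split=> // v u gv; apply: cov; rewrite inE; apply/existsP.
by exists v; rewrite gv.
Qed.

End Rainbow.

(** * Probe programs *)

Section Programs.

Variables S w : nat.
Local Notation prog := (probe_tree S w).
Local Notation data := (S.-tuple (word w)).

Fixpoint bind (O O' : Type) (p : prog O) (k : O -> prog O') : prog O' :=
  match p with
  | Output o => k o
  | Probe i next => Probe i (fun x => bind (next x) k)
  end.

Definition yields (O : Type) (p : prog O) (D : data) (n : nat) (Q : O -> Prop) : Prop :=
  num_probes p D <= n /\ Q (run p D).

Lemma yields_bind (O O' : Type) (p : prog O) (k : O -> prog O') D n1 n2 n Q :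
  yields p D n1 (fun x => yields (k x) D n2 Q) -> n1 + n2 <= n -> yields (bind p k) D n Q.
Proof.
move=> [lep [lek Qk]] le.
rewrite /yields; have [-> ->] : run (bind p k) D = run (k (run p D)) D /\
    num_probes (bind p k) D = num_probes p D + num_probes (k (run p D)) D.
  by elim: (p) => [o|i next IH] //=; have [-> ->] := IH (tnth D i).
by split=> //; apply: leq_trans le; exact: leq_add.
Qed.

Lemma yields_weaken (O : Type) (p : prog O) D n n' (Q Q' : O -> Prop) :
  yields p D n Q -> n <= n' -> (forall o, Q o -> Q' o) -> yields p D n' Q'.
Proof. by case=> le Qo le' QQ'; split; [exact: leq_trans le'|exact: QQ']. Qed.

Fixpoint map_prog (X O : Type) (f : X -> prog O) (xs : seq X) : prog (seq O) :=
  if xs is x :: xs' then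
    bind (f x) (fun o => bind (map_prog f xs') (fun os => Output _ _ (o :: os)))
  else Output _ _ [::].

Lemma yields_map (X O : Type) (f : X -> prog O) (F : X -> O) D n :
  (forall x, yields (f x) D n (eq (F x))) ->
  forall xs, yields (map_prog f xs) D (size xs * n) (eq (map F xs)).
Proof.
move=> fF; elim=> [|x xs IH] //=; apply: (yields_bind (n1 := n) (n2 := size xs * n)) => //.
apply: yields_weaken (fF x) _ _ => // _ <-.
apply: (yields_bind (n1 := size xs * n) (n2 := 0)); last by rewrite addn0.
by apply: yields_weaken IH _ _ => // _ <-.
Qed.

Fixpoint first_prog (O : Type) (ps : seq (prog (option O))) : prog (option O) :=
  if ps is p :: ps' then
    bind p (fun o => if o is Some x then Output _ _ (Some x) else first_prog ps')
  else Output _ _ None.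

(** Attempts may fail but must not answer wrongly, so stopping at the first answer is safe and wrong
    guesses of table and level do no harm. *)
Lemma yields_first (X : eqType) (O : Type) (f : X -> prog (option O)) D n (Q : O -> Prop) xs :
  {in xs, forall x, yields (f x) D n (fun o => if o is Some v then Q v else True)} ->
  (exists2 x, x \in xs & yields (f x) D n (fun o => o <> None)) ->
  yields (first_prog (map f xs)) D (size xs * n) (fun o => exists2 v, o = Some v & Q v).
Proof.
elim: xs => [|x xs IH] sound [x0 x0in found] //=.
have soundx := sound x (mem_head _ _).
apply: (yields_bind (n1 := n) (n2 := size xs * n)); last by rewrite mulSn.
case: soundx => lex Qx; split=> //; case e: (run (f x) D) Qx => [v|] Qv.
  by split=> //; exists v.
apply: IH => [y yin|]; first by apply: sound; rewrite in_cons yin orbT.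
move: x0in; rewrite in_cons => /orP[/eqP xx|]; last by exists x0.
by case: found => _; rewrite xx e.
Qed.

End Programs.

Lemma card_le_pcan (A B : finType) : #|A| <= #|B| ->
  exists (e : A -> B) (d : B -> option A), pcancel e d.
Proof.
move=> le.
exists (fun a => enum_val (widen_ord le (enum_rank a))).
exists (fun b => omap enum_val (insub (val (enum_rank b)) : option 'I_#|A|)).
by move=> a; rewrite enum_valK /= valK /= enum_rankK.
Qed.

(* One bit per word: this costs only a logarithmic factor. *)
Lemma cells_exist (Addr Val : finType) (S w L : nat) (v0 : Val) :
  0 < w -> #|Addr| * L <= S -> #|Val| <= 2 ^ L ->
  exists (store : (Addr -> Val) -> S.-tuple (word w))
         (read : Addr -> probe_tree S w Val),
    forall mem a, yields (read a) (store mem) L (eq (mem a)).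
Proof.
move=> w0 leS leL.
have [|enc [dec encK]] := @card_le_pcan Val {: L.-tuple bool}.
  by rewrite card_tuple card_bool.
have [|ad [da adK]] := @card_le_pcan (Addr * 'I_L)%type 'I_S.
  by rewrite card_prod !card_ord.
pose bit (mem : Addr -> Val) (x : 'I_S) : bool :=
  if da x is Some (a, i) then tnth (enc (mem a)) i else false.
exists (fun mem => [tuple [tuple of nseq w (bit mem x)] | x < S]).
exists (fun a => bind (map_prog (fun j => Probe (ad (a, j)) (fun x => Output S w (head false x)))
                                (enum 'I_L))
   (fun bs => Output S w (odflt v0 (obind dec (insub bs))))).
move=> mem a; set D := [tuple _ | x < S].
apply: (yields_bind (n1 := L) (n2 := 0)); last by rewrite addn0.
apply: yields_weaken (yields_map (F := tnth (enc (mem a))) (n := 1) _ _) _ _ => [j||bs <-].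
- split=> //=; rewrite tnth_mktuple /bit adK /=.
  by case: (w) w0 => // w' _.
- by rewrite size_enum_ord muln1.
- by split=> //=; rewrite map_tnth_enum valK /= encK.
Qed.

(** * Sorted dictionaries with binary search *)

Section Dictionary.

Variables (Key : finType) (Info : Type) (n J : nat).
Hypothesis nJ : n <= 2 ^ J.

Section Lookup.

Variables (S w : nat) (rd : 'I_n -> probe_tree S w (option (Key * Info))).

(** The window is [lo <= x < lo + 2 ^ j]. Empty cells and positions outside the array count as too
    large. The result means something only for a stored key, which is why [lookup] compares keys
    once more. *)
Fixpoint search (key : Key) (lo j : nat) : probe_tree S w nat :=
  if j is j'.+1 then
    if insub (lo + 2 ^ j') is Some i then
      bind (rd i) (fun c =>
        if c is Some (k, _) then
          if enum_rank k <= enum_rank key then search key (lo + 2 ^ j') j'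
          else search key lo j'
        else search key lo j')
    else search key lo j'
  else Output S w lo.

Definition lookup (key : Key) : probe_tree S w (option Info) :=
  bind (search key 0 J) (fun x =>
    if insub x is Some i then
      bind (rd i) (fun c => Output S w
        (if c is Some (k, v) then if k == key then Some v else None else None))
    else Output S w None).

End Lookup.

(** The entries are sorted by [enum_rank] and packed to the front, so comparing ranks is comparing
    positions. The contents [c] are fixed before the memory and the reader, so they can be placed
    inside a larger structure. *)
Lemma dictionary_exists (phi : Key -> option Info) :
  #|[set k | isSome (phi k)]| <= n ->
  exists c : 'I_n -> option (Key * Info),
  forall S w (rd : 'I_n -> probe_tree S w (option (Key * Info))) D L,
    (forall i, yields (rd i) D L (eq (c i))) ->
  forall key, yields (lookup rd key) D (J.+1 * L) (eq (phi key)).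
Proof.
move=> le_n.
pose ks := sort (relpre enum_rank (fun x y : 'I_#|Key| => x <= y))
                (enum [set k | isSome (phi k)]).
have mem_ks k : (k \in ks) = isSome (phi k) by rewrite mem_sort mem_enum inE.
have uniq_ks : uniq ks by rewrite sort_uniq enum_uniq.
have size_ks : size ks <= n by rewrite size_sort -cardE.
pose entry k := omap (pair k) (phi k).
exists (fun i : 'I_n => nth None (map entry ks) i).
move=> S w rd D L rdc key.
pose ix := index key ks.
have cmp x : x < size ks -> key \in ks ->
    (enum_rank (nth key ks x) <= enum_rank key) = (x <= ix).
  move=> xlt kin; have ixlt : ix < size ks by rewrite index_mem.
  have srt : sorted (relpre enum_rank (fun x y : 'I_#|Key| => x <= y)) ks.
    by apply: sort_sorted => a b; exact: leq_total.
  have mono := sorted_leq_nth (leT := relpre enum_rank (fun x y : 'I_#|Key| => x <= y))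
      (fun b a c => @leq_trans (enum_rank b) (enum_rank a) (enum_rank c))
      (fun a => leqnn (enum_rank a)) key srt.
  have keyE : nth key ks ix = key by rewrite nth_index.
  apply/idP/idP => [le|xix]; last by have := mono x ix xlt ixlt xix; rewrite keyE.
  rewrite leqNgt; apply/negP => ixx.
  have le' := mono ix x ixlt xlt (ltnW ixx); rewrite keyE /= in le'.
  have /val_inj/enum_rank_inj e : val (enum_rank (nth key ks x)) = val (enum_rank key).
    by apply/eqP; rewrite eqn_leq le le'.
  by move: ixx; rewrite /ix -{1}e index_uniq // ltnn.
have search_ok j lo : yields (search rd key lo j) D (j * L)
    (fun x => key \in ks -> lo <= ix < lo + 2 ^ j -> x = ix).
  elim: j lo => [|j IH] lo /=.
    by split=> //= _; rewrite expn0 addn1 ltnS -eqn_leq => /eqP.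
  have stay : (key \in ks -> lo <= ix < lo + 2 ^ j.+1 -> ix < lo + 2 ^ j) ->
      yields (search rd key lo j) D (j * L)
        (fun x => key \in ks -> lo <= ix < lo + 2 ^ j.+1 -> x = ix).
    move=> lt; apply: yields_weaken (IH lo) _ _ => // x H kin rng.
    by apply: H => //; case/andP: (rng) => -> _; exact: lt.
  case: insubP => [i _ iE|]; last first.
    rewrite -leqNgt => ge; apply: yields_weaken (stay _) (leq_addl _ _) _ => //.
    move=> kin _; apply: leq_trans ge; apply: leq_trans size_ks.
    by rewrite index_mem.
  apply: (yields_bind (n1 := L) (n2 := j * L)); last by rewrite mulSn.
  apply: yields_weaken (rdc i) _ _ => // _ <-; rewrite iE.
  case: (ltnP (lo + 2 ^ j) (size ks)) => [lt|ge]; last first.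
    rewrite nth_default ?size_map //; apply: stay => kin _.
    by apply: leq_trans ge; rewrite index_mem.
  rewrite (nth_map key) //.
  have : isSome (phi (nth key ks (lo + 2 ^ j))) by rewrite -mem_ks mem_nth.
  rewrite /entry; case: (phi _) => //= v _; case: ifPn => [le|gt].
    apply: yields_weaken (IH _) _ _ => // x H kin /andP[_ lt2]; apply: H => //.
    by rewrite -cmp // le /= -addnA addnn -mul2n -expnS.
  by apply: stay => kin _; rewrite cmp // -ltnNge in gt.
apply: (yields_bind (n1 := J * L) (n2 := L)); last by rewrite mulSn addnC.
apply: yields_weaken (search_ok J 0) _ _ => // x xP.
case: insubP => [i ilt iE|]; last first.
  move=> nlt; split=> //=; case e: (phi key) => [v|] //; case/negP: nlt.
  have kin : key \in ks by rewrite mem_ks e.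
  rewrite xP // ?add0n; first by apply: leq_trans size_ks; rewrite index_mem.
  by apply: leq_trans nJ; apply: leq_trans size_ks; rewrite index_mem.
apply: (yields_bind (n1 := L) (n2 := 0)); last by rewrite addn0.
apply: yields_weaken (rdc i) _ _ => // _ <-; split=> //=; rewrite iE.
case: (ltnP x (size ks)) => [lt|ge]; last first.
  rewrite nth_default ?size_map //; case e: (phi key) => [v|] //.
  have kin : key \in ks by rewrite mem_ks e.
  move: ge; rewrite xP // ?add0n; first by rewrite leqNgt index_mem kin.
  by apply: leq_trans nJ; apply: leq_trans size_ks; rewrite index_mem.
rewrite (nth_map key) // /entry.
case e': (phi (nth key ks x)) => [v'|] /=; last first.
  by have := mem_nth key lt; rewrite mem_ks e'.
case: eqP => [ek|nk]; first by rewrite -e' ek.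
case e: (phi key) => [v|] //; case: nk.
have kin : key \in ks by rewrite mem_ks e.
rewrite xP // ?add0n ?nth_index //.
by apply: leq_trans nJ; apply: leq_trans size_ks; rewrite index_mem.
Qed.

End Dictionary.

(** * Inverting a function *)

Section Inversion.

Variables (V : finZmodType) (Y : finType) (m r t nT nH J : nat).
Variable code : 'I_m + Y -> {set 'I_r}.

Local Notation seed := (hash_seed V r).
Local Notation pos := ('I_m + Y)%type.

Section Query.

Variables (S w : nat).
Local Notation prog := (probe_tree S w).
Variable read_heavy : 'I_nH -> prog (option (Y * V)).
Variable read_seed : 'I_nT -> 'I_t -> prog seed.
Variable read_end : 'I_nT -> 'I_m -> prog (option (pos * 'I_m)).
Variable evalf : V -> prog (option Y).

(** Computes [light_part] online: a value is light exactly when the heavy dictionary has no entry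
    for it. *)
Definition light_prog (v : V) : prog (option Y) :=
  bind (evalf v) (fun o => if o is Some y then
    bind (lookup J read_heavy y) (fun h => Output S w (if h is Some _ then None else Some y))
  else Output S w None).

Definition step_prog (x : 'I_nT) (j : 'I_t) (z : pos) : prog pos :=
  bind (read_seed x j) (fun s =>
    bind (light_prog (hash code s z)) (fun o =>
      Output S w (if o is Some u then inr u else z))).

Fixpoint walk_prog (x : 'I_nT) (js : seq 'I_t) (z : pos) : prog pos :=
  if js is j :: js' then bind (step_prog x j z) (walk_prog x js') else Output S w z.

(** The last evaluation of [f] filters false alarms: the chain found at the endpoint need not have
    visited [y] at level [j]. *)
Definition try_prog (y : Y) (xj : 'I_nT * 'I_t) : prog (option V) :=
  let: (x, j) := xj in
  bind (walk_prog x (drop j.+1 (enum 'I_t)) (inr y)) (fun z =>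
  bind (lookup J (read_end x) z) (fun oi =>
    if oi is Some i then
      bind (walk_prog x (take j (enum 'I_t)) (inl i)) (fun z' =>
      bind (read_seed x j) (fun s =>
      bind (evalf (hash code s z')) (fun o =>
        Output S w (if o == Some y then Some (hash code s z') else None))))
    else Output S w None)).

Definition invert_prog (y : Y) : prog (option V) :=
  first_prog (map (fun o => if o is Some xj then try_prog y xj else lookup J read_heavy y)
    (None :: map Some (enum {: 'I_nT * 'I_t}))).

End Query.

Definition light_part (f : V -> option Y) (v : V) : option Y :=
  if f v is Some y then
    if #|[set v' | f v' == Some y]| <= t then Some y else None
  else None.

Lemma card_light_fiber f u : #|[set v | light_part f v == Some u]| <= t.
Proof.
case: (leqP #|[set v | f v == Some u]| t) => le.
  apply: leq_trans le; apply/subset_leq_card/subsetP => v; rewrite !inE /light_part.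
  by case: (f v) => // y; case: ifP.
rewrite (_ : [set v | _] = set0) ?cards0 //; apply/setP => v; rewrite !inE /light_part.
case: (f v) => // y; case: ifP => // ley; apply/eqP => -[yu].
by rewrite yu leqNgt le in ley.
Qed.

Definition heavy_preimage (f : V -> option Y) (y : Y) : option V :=
  if t < #|[set v | f v == Some y]| then [pick v | f v == Some y] else None.

Lemma card_heavy f : 0 < t -> #|[set y | isSome (heavy_preimage f y)]| <= #|V| %/ t.
Proof.
move=> tgt; rewrite leq_divRL //; apply: leq_trans (sum_card_fibers f).
rewrite -sum_nat_const big_mkcond; apply: leq_sum => y _; rewrite inE.
by rewrite /heavy_preimage; case: ltnP => // /ltnW ?; case: ifP.
Qed.

(** There are [nT * t] guesses and one heavy lookup. A guess makes two walks of at most [t] levels,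
    each level reading a seed, evaluating [f] and searching the heavy dictionary; then come the
    endpoint lookup, one more seed and one more evaluation. *)
Definition query_cost (L E : nat) : nat :=
  (nT * t).+1 * (2 * (t * (L + (E + J.+1 * L))) + (J.+2 * L + E)).

(** A heavy [y] is answered by its dictionary. A light [y] is visited by an alive chain of some
    table, and the guess of that table and level succeeds. The contents depend on [f] only, so all
    readers can share one memory. *)
Lemma inversion_structure (q n : nat) (f : V -> option Y) :
  injective code -> 0 < t -> 18 * m * t ^ 2 <= #|V| -> 2 * #|V| <= q * t * m ->
  #|V| < 2 ^ n -> nT = q * n -> #|V| %/ t <= nH -> nH <= 2 ^ J -> m <= 2 ^ J ->
  exists (ch : 'I_nH -> option (Y * V)) (cs : 'I_nT -> 'I_t -> seed)
         (ce : 'I_nT -> 'I_m -> option (pos * 'I_m)),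
  forall S w D L E read_heavy read_seed read_end (evalf : V -> probe_tree S w (option Y)),
    (forall i, yields (read_heavy i) D L (eq (ch i))) ->
    (forall x j, yields (read_seed x j) D L (eq (cs x j))) ->
    (forall x i, yields (read_end x i) D L (eq (ce x i))) ->
    (forall v, yields (evalf v) D E (eq (f v))) ->
  forall y v, f v = Some y ->
    yields (invert_prog read_heavy read_seed read_end evalf y) D (query_cost L E)
      (fun o => exists2 v', o = Some v' & f v' = Some y).
Proof.
move=> codeI tgt msmall mlarge ltn nTE nHle nHJ mJ.
pose g := light_part f.
have [tbs [sz ok cov]] := rainbow_cover codeI (card_light_fiber f) tgt msmall mlarge ltn.
pose s0 : seed := (0%R, [ffun=> 0%R]).
pose tb (x : 'I_nT) := nth ([::], set0) tbs x.
pose ht := hit g code.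
have tb_in (x : 'I_nT) : tb x \in tbs by rewrite mem_nth // sz -nTE.
pose endp x (z : pos) : option 'I_m := [pick i in (tb x).2 | walk ht (tb x).1 (inl i) == z].
have [ch chP] := dictionary_exists nHJ (leq_trans (card_heavy f tgt) nHle).
have endp_card x : #|[set z | isSome (endp x z)]| <= m.
  rewrite -[X in _ <= X]card_ord -cardsT.
  apply: leq_trans (leq_imset_card (fun i => walk ht (tb x).1 (inl i)) _).
  apply/subset_leq_card/subsetP => z; rewrite inE /endp; case: pickP => // i /andP[_ /eqP <-] _.
  exact: imset_f.
have /fin_all_exists [ce ceP] : forall x, exists c : 'I_m -> option (pos * 'I_m),
  forall S w (rd : 'I_m -> probe_tree S w (option (pos * 'I_m))) D L,
    (forall i, yields (rd i) D L (eq (c i))) ->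
  forall key, yields (lookup J rd key) D (J.+1 * L) (eq (endp x key)).
  move=> x; exact: (dictionary_exists mJ (endp_card x)).
exists ch, (fun x j => nth s0 (tb x).1 j), ce.
move=> S w D L E rh rs re evalf rhP rsP reP evP y v fv.
have lookH := chP _ _ _ _ _ rhP.
have lookE x := ceP x _ _ _ _ _ (reP x).
have lightP v' : yields (light_prog rh evalf v') D (E + J.+1 * L) (eq (g v')).
  apply: (yields_bind (n1 := E) (n2 := J.+1 * L)) => //.
  apply: yields_weaken (evP v') _ _ => // _ <-; rewrite /g /light_part.
  case fv' : (f v') => [y'|] //.
  apply: (yields_bind (n1 := J.+1 * L) (n2 := 0)); last by rewrite addn0.
  apply: yields_weaken (lookH y') _ _ => // _ <-; split=> //=.
  rewrite /heavy_preimage ltnNge; case: leqP => //= _; case: pickP => // /(_ v').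
  by rewrite fv' eqxx.
have stepP x j z : yields (step_prog rh rs evalf x j z) D (L + (E + J.+1 * L))
    (eq (step ht (nth s0 (tb x).1 j) z)).
  apply: (yields_bind (n1 := L) (n2 := E + J.+1 * L)) => //.
  apply: yields_weaken (rsP x j) _ _ => // _ <-.
  apply: (yields_bind (n1 := E + J.+1 * L) (n2 := 0)); last by rewrite addn0.
  by apply: yields_weaken (lightP _) _ _ => // _ <-; split.
have walkP x js z : yields (walk_prog rh rs evalf x js z) D (size js * (L + (E + J.+1 * L)))
    (eq (walk ht (map (fun j : 'I_t => nth s0 (tb x).1 j) js) z)).
  elim: js z => [|j js IH] z //=.
  apply: yields_bind; last by rewrite mulSn.
  by apply: yields_weaken (stepP x j z) _ _ => // _ <-; exact: IH.
have map_seeds x : map (fun j : 'I_t => nth s0 (tb x).1 j) (enum 'I_t) = (tb x).1.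
  have [szx _] := ok _ (tb_in x).
  by rewrite -[RHS](mkseq_nth s0) /mkseq szx -val_enum_ord -map_comp.
have walk_cost (js : seq 'I_t) : size js <= t -> size js * (L + (E + J.+1 * L)) <= t * (L + (E + J.+1 * L)).
  by move=> le; rewrite leq_mul2r le orbT.
have size_drop_le j : size (drop j (enum 'I_t)) <= t.
  by rewrite size_drop size_enum_ord leq_subr.
have size_take_le j : size (take j (enum 'I_t)) <= t.
  by rewrite size_take_min size_enum_ord geq_minr.
have tryP x j : yields (try_prog rh rs re evalf y (x, j)) D
    (2 * (t * (L + (E + J.+1 * L))) + (J.+2 * L + E))
    (eq (if endp x (walk ht (drop j.+1 (tb x).1) (inr y)) is Some i then
           let v' := hash code (nth s0 (tb x).1 j) (walk ht (take j (tb x).1) (inl i)) in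
           if f v' == Some y then Some v' else None
         else None)).
  rewrite /try_prog mul2n -addnn -addnA.
  apply: yields_bind; last exact: leqnn.
  apply: yields_weaken (walkP _ _ _) (walk_cost _ (size_drop_le _)) _ => _ <-.
  rewrite map_drop map_seeds (_ : _ + _ = J.+1 * L + (t * (L + (E + J.+1 * L)) + (L + E))); last first.
    by rewrite [in J.+2 * L]mulSn; lia.
  apply: yields_bind; last exact: leqnn.
  apply: yields_weaken (lookE x _) _ _ => // _ <-.
  case: (endp x _) => [i|]; last by split.
  apply: yields_bind; last exact: leqnn.
  apply: yields_weaken (walkP _ _ _) (walk_cost _ (size_take_le _)) _ => _ <-.
  rewrite map_take map_seeds; apply: yields_bind; last exact: leqnn.
  apply: yields_weaken (rsP x j) _ _ => // _ <-.
  apply: (yields_bind (n1 := E) (n2 := 0)); last by rewrite addn0.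
  by apply: yields_weaken (evP _) _ _ => // _ <-; split.
rewrite /query_cost; set C := _ + (J.+2 * L + E).
have lookC : J.+1 * L <= C by rewrite /C; lia.
have -> : (nT * t).+1 = size (None :: map Some (enum {: 'I_nT * 'I_t})).
  by rewrite /= size_map -cardE card_prod !card_ord.
apply: yields_first => [[[x j]|] _|].
- apply: yields_weaken (tryP x j) _ _ => // o <-.
  by case: (endp x _) => //= i; case: eqP.
- apply: yields_weaken (lookH y) lookC _ => o <-; rewrite /heavy_preimage.
  by case: ifP => // _; case: pickP => // v' /eqP.
case: (leqP #|[set v' | f v' == Some y]| t) => [light|heavy]; last first.
  exists None; rewrite ?mem_head //; apply: yields_weaken (lookH y) lookC _ => o <-.
  by rewrite /heavy_preimage heavy; case: pickP => // /(_ v); rewrite fv eqxx.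
have gv : g v = Some y by rewrite /g /light_part fv light.
(* The length of the prefix [s1] before the hit is the level to guess. *)
have [tb0 tb0in [i iAl [s1 [s [s2 [ssE hs]]]]]] := cov v y gv.
have ltx : index tb0 tbs < nT by rewrite nTE -sz index_mem.
pose x := Ordinal ltx; have tbE : tb x = tb0 by rewrite /tb nth_index.
have [szx injx] := ok _ tb0in.
have ltj : size s1 < t by rewrite -szx ssE size_cat /= addnS ltnS leq_addr.
pose j := Ordinal ltj; exists (Some (x, j)).
  by rewrite in_cons /= map_f // mem_enum.
apply: yields_weaken (tryP x j) _ _ => // o <-; rewrite tbE ssE /=.
rewrite -cat_rcons drop_size_cat ?size_rcons // cat_rcons take_size_cat //.
rewrite nth_cat ltnn subnn /=.
(* From the hit on, the chain and the walk from [y] coincide; distinct endpoints of alive chains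
   then single out [i]. *)
have -> : endp x (walk ht s2 (inr y)) = Some i.
  have wE : walk ht (tb x).1 (inl i) = walk ht s2 (inr y).
    by rewrite tbE ssE /walk foldl_cat /=; congr foldl; rewrite /step [ht _ _]hs.
  rewrite /endp -wE tbE; case: pickP => [i' /andP[i'Al /eqP e]|/(_ i)].
    by rewrite (injx i' i).
  by rewrite iAl eqxx.
move: hs; rewrite /hit /g /light_part /ht; case: (f _) => // y'.
by case: ifP => // _ [->]; rewrite eqxx.
Qed.

End Inversion.

(** * kSUM-Indexing *)

Lemma query_setP (k : nat) (G : finZmodType) (N : nat) (A : N.-tuple G) (b : G) :
  reflect (exists2 I : {set 'I_N}, #|I| = k.-1 & index_sum A I = b) (b \in query_set k A).
Proof.
apply: (iffP imsetP) => [[I]|[I cI <-]].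
  by rewrite inE => /eqP cI ->; exists I.
by exists I; rewrite ?inE ?cI.
Qed.

(** The stored data is [A] itself; once all of it has been read, the search over index sets is
    free. *)
Lemma exhaustive_structure (k : nat) (G : finZmodType) (N w L S T : nat) :
  0 < w -> #|G| <= 2 ^ L -> N * L <= S -> N * L <= T ->
  exists P : data_structure G N w S, solves_kSUM_indexing k T P.
Proof.
move=> w0 leG leS leT.
have leS' : #|'I_N| * L <= S by rewrite card_ord.
have [store [read readP]] := cells_exist (0%R : G) w0 leS' leG.
pose answer (b : G) (s : seq G) : {set 'I_N} := odflt set0
  [pick I : {set 'I_N} | (#|I| == k.-1) && ((\sum_(i in I) nth 0 s i)%R == b)].
exists (DataStructure (fun A => store (tnth A))
  (fun b => bind (map_prog read (enum 'I_N)) (fun s => Output S w (answer b s)))).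
move=> A b /query_setP[I cI sI] /=.
suff [le [cA sA]] : yields (bind (map_prog read (enum 'I_N)) (fun s => Output S w (answer b s)))
    (store (tnth A)) T (fun I => #|I| = k.-1 /\ index_sum A I = b) by [].
apply: (yields_bind (n1 := N * L) (n2 := 0)); last by rewrite addn0.
apply: yields_weaken (yields_map (readP (tnth A)) _) _ _ => [|s <-]; first by rewrite size_enum_ord.
split=> //=; have sumE (K : {set 'I_N}) :
    (\sum_(i in K) nth 0 [seq tnth A i | i <- enum 'I_N] i)%R = index_sum A K.
  apply: eq_bigr => i _.
  by rewrite map_tnth_enum -tnth_nth.
rewrite /answer; case: pickP => [K /andP[/eqP cK /eqP sK]|/(_ I)] /=.
  by rewrite -sumE.
by rewrite sumE cI sI !eqxx.
Qed.

(** * The indexing structure built from rainbow tables *)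

Section TableStructure.

Variables (k N' : nat) (G : finZmodType).
Local Notation N := N'.+1.
Local Notation V := 'rV['I_N]_(k.-1).

(** Index tuples are row vectors over ['I_N] because hashing needs a group as the domain of [f];
    hence [N] is written as a successor. A tuple with repeated indices has too small a support and
    counts as a miss. *)
Definition tuple_sum (A : N.-tuple G) (v : V) : option G :=
  if injectiveb (fun j => v ord0 j) then Some (\sum_j tnth A (v ord0 j))%R else None.

Definition support_set (v : V) : {set 'I_N} := [set v ord0 j | j : 'I_(k.-1)].

Lemma tuple_sum_Some (A : N.-tuple G) (v : V) (b : G) : tuple_sum A v = Some b ->
  #|support_set v| = k.-1 /\ index_sum A (support_set v) = b.
Proof.
rewrite /tuple_sum; case: injectiveP => // inj [<-].
rewrite /support_set card_imset // card_ord; split=> //.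
by rewrite /index_sum big_imset //=; apply: in2W.
Qed.

Lemma tuple_sum_ex (A : N.-tuple G) (b : G) : b \in query_set k A ->
  exists v, tuple_sum A v = Some b.
Proof.
case/query_setP => I cI sI.
pose e (j : 'I_(k.-1)) : 'I_N := enum_val (cast_ord (esym cI) j).
have eI : injective e by move=> i j /enum_val_inj/cast_ord_inj.
exists (\row_j e j)%R; rewrite /tuple_sum.
have vE j : (\row_j e j)%R ord0 j = e j by rewrite mxE.
case: injectiveP => [_|[]]; last by move=> i j; rewrite !vE => /eI.
congr Some; rewrite -sI /index_sum (eq_bigr (fun j => tnth A (e j))) => [|j _]; last by rewrite vE.
rewrite -(big_imset (tnth A)) => [|i j _ _ /eI //]; apply: eq_bigl => i.
apply/imsetP/idP => [[j _ ->]|iI]; first exact: enum_valP.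
by exists (cast_ord cI (enum_rank_in iI i)); rewrite // /e cast_ordK enum_rankK_in.
Qed.

Lemma table_structure (w L S T m r t q n J : nat) :
  let M := N ^ k.-1 in
  let nH := M %/ t in let nT := q * n in
  0 < w -> 0 < t -> 18 * m * t ^ 2 <= M -> 2 * M <= q * t * m -> M < 2 ^ n ->
  M <= 2 ^ J -> m + #|G| <= 2 ^ r ->
  #|G| * (#|G| * M).+1 * (M * M ^ r) * ((m + #|G|) * m).+1 <= 2 ^ L ->
  (N + nH + nT * t + nT * m) * L <= S ->
  query_cost t nT J L (k.-1 * L) <= T ->
  exists P : data_structure G N w S, solves_kSUM_indexing k T P.
Proof.
move=> M nH nT w0 t0 msmall mlarge ltn leJ ler leL leS leT.
have cardV : #|{: V}| = M by rewrite card_mx card_ord mul1n.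
have [|code [decode codeK]] := @card_le_pcan ('I_m + G)%type {set 'I_r}.
  rewrite card_sum card_ord (leq_trans ler) // -[X in _ <= X]cardsT -powersetT.
  by rewrite card_powerset cardsT card_ord.
have codeI := pcan_inj codeK.
pose Addr := ('I_N + 'I_nH + ('I_nT * 'I_t) + ('I_nT * 'I_m))%type.
(* One uniform cell type for the four regions: array, heavy dictionary, seeds and endpoints. Only
   the field that belongs to the region is meaningful, the others hold defaults. *)
pose Val := (G * option (G * V) * hash_seed V r * option (('I_m + G) * 'I_m))%type.
have leS' : #|{: Addr}| * L <= S by rewrite !card_sum !card_prod !card_ord.
have leL' : #|{: Val}| <= 2 ^ L.
  by rewrite !card_prod !card_option !card_prod card_ffun card_sum !card_ord cardV.
pose s0 : hash_seed V r := (0%R, [ffun=> 0%R]).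
have [store [read readP]] := cells_exist (((0%R : G), None, s0, None) : Val) w0 leS' leL'.
have mM : m <= M.
  by apply: leq_trans msmall; rewrite mulnAC leq_pmull // muln_gt0 expn_gt0 t0.
have [nHJ mJ] : nH <= 2 ^ J /\ m <= 2 ^ J.
  by split; apply: leq_trans leJ => //; exact: leq_div.
pose query_prog (F : Type) (pr : Val -> F) (a : Addr) : probe_tree S w F :=
  bind (read a) (fun v => Output S w (pr v)).
have fieldP (F : Type) (pr : Val -> F) mem a :
    yields (query_prog F pr a) (store mem) L (eq (pr (mem a))).
  apply: (yields_bind (n1 := L) (n2 := 0)); last by rewrite addn0.
  by apply: yields_weaken (readP mem a) _ _ => // _ <-.
pose readA (i : 'I_N) := query_prog _ (fun v => v.1.1.1) (inl (inl (inl i))).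
pose readH (i : 'I_nH) := query_prog _ (fun v => v.1.1.2) (inl (inl (inr i))).
pose readS (x : 'I_nT) (j : 'I_t) := query_prog _ (fun v => v.1.2) (inl (inr (x, j))).
pose readE (x : 'I_nT) (i : 'I_m) := query_prog _ (fun v => v.2) (inr (x, i)).
pose evalf (v : V) : probe_tree S w (option G) :=
  if injectiveb (fun j => v ord0 j) then
    bind (map_prog (fun j => readA (v ord0 j)) (enum 'I_(k.-1)))
      (fun s => Output S w (Some (\sum_(a <- s) a)%R))
  else Output S w None.
pose query b := bind (invert_prog J code readH readS readE evalf b)
  (fun o => Output S w (if o is Some v then support_set v else set0)).
have /fin_all_exists [mem memP] (A : N.-tuple G) : exists mem : Addr -> Val,
    forall b, b \in query_set k A -> yields (query b) (store mem) T
      (fun I => #|I| = k.-1 /\ index_sum A I = b).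
  have [||||ch [cs [ce invP]]] := @inversion_structure V G m r t nT nH J code q n
    (tuple_sum A) codeI t0 _ _ _ erefl _ nHJ mJ; rewrite ?cardV //.
  pose mem (a : Addr) : Val := match a with
    | inl (inl (inl i)) => (tnth A i, None, s0, None)
    | inl (inl (inr i)) => (0%R, ch i, s0, None)
    | inl (inr (x, j)) => (0%R, None, cs x j, None)
    | inr (x, i) => (0%R, None, s0, ce x i)
    end.
  exists mem => b /tuple_sum_ex[v fv].
  apply: (yields_bind (n1 := query_cost t nT J L (k.-1 * L)) (n2 := 0)); last first.
    by rewrite addn0.
  apply: yields_weaken (invP S w (store mem) L (k.-1 * L) readH readS readE evalf
      _ _ _ _ b v fv) _ _ => //.
  - by move=> i; exact: (fieldP _ (fun v => v.1.1.2) mem).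
  - by move=> x j; exact: (fieldP _ (fun v => v.1.2) mem).
  - by move=> x i; exact: (fieldP _ (fun v => v.2) mem).
  - move=> v'; rewrite /evalf /tuple_sum; case: ifP => // _.
    apply: (yields_bind (n1 := k.-1 * L) (n2 := 0)); last by rewrite addn0.
    apply: yields_weaken (yields_map (F := fun j => tnth A (v' ord0 j)) (n := L) _ _) _ _.
    + by move=> j; exact: (fieldP _ (fun v => v.1.1.1) mem).
    + by rewrite size_enum_ord.
    + by move=> _ <-; split=> //=; rewrite big_map big_enum.
  - by move=> _ [v' -> /tuple_sum_Some].
exists (DataStructure (fun A => store (mem A)) query) => A b /memP[le [cI sI]].
by split.
Qed.

End TableStructure.

(** * Choice of the parameters *)

Definition bit_budget (k w N : nat) : nat := k.-1 * (trunc_log 2 N).+1 + w + 1.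

(** The seed, with its [B.+1] domain elements of at most [kappa] bits each, makes the bound
    quadratic in [B]; the other factors need linearly many bits. *)
Lemma cell_bits (g M m kappa w : nat) (B := kappa + w + 1) :
  g <= 2 ^ w -> M <= 2 ^ kappa -> m <= M ->
  g * (g * M).+1 * (M * M ^ B) * ((m + g) * m).+1 <= 2 ^ (6 * B ^ 2).
Proof.
move=> gle Mle mM; have mle := leq_trans mM Mle.
have succ_le a e : a <= 2 ^ e -> a.+1 <= 2 ^ e.+1.
  by move=> le; rewrite expnS mul2n -addnn -addn1 leq_add // expn_gt0.
have le1 : (g * M).+1 <= 2 ^ (w + kappa).+1 by rewrite succ_le // expnD leq_mul.
have le2 : M * M ^ B <= 2 ^ (kappa * B.+1).
  by rewrite -expnS expnM leq_exp2r.
have le3 : m + g <= 2 ^ (kappa + w).+1.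
  rewrite expnS mul2n -addnn leq_add //.
    by apply: leq_trans mle _; rewrite leq_exp2l // leq_addr.
  by apply: leq_trans gle _; rewrite leq_exp2l // leq_addl.
have le4 : ((m + g) * m).+1 <= 2 ^ ((kappa + w).+1 + kappa).+1.
  by rewrite succ_le // [2 ^ (_ + _)]expnD leq_mul.
apply: leq_trans (leq_mul (leq_mul (leq_mul gle le1) le2) le4) _.
by rewrite -!expnD leq_exp2l // /B; nia.
Qed.

(** The tables use about [M / (18 * t ^ 2)] chains, [72 * t * kappa] tables and cells of [6 * B ^ 2]
    bits, where [M < 2 ^ kappa]. They are used when [t ^ 3 <= N] and there is at least one chain;
    otherwise [A] is read completely. *)
Lemma kSUM_structure (k N w t : nat) (G : finZmodType) (B := bit_budget k w N) :
  2 < k -> 0 < N -> 0 < w -> 0 < t -> #|G| <= 2 ^ w ->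
  exists P : data_structure G N w (468 * B ^ 3 * (N + N ^ k.-1 %/ t)),
    solves_kSUM_indexing k (2628 * B ^ 4 * t ^ 3) P.
Proof.
case: N @B => // N' B k2 _ w0 t0 leG; set N := N'.+1 in B *; set M := N ^ k.-1.
set kappa := k.-1 * (trunc_log 2 N).+1.
have BE : B = kappa + w + 1 by [].
have MltK : M < 2 ^ kappa.
  rewrite /kappa mulnC expnM ltn_exp2r ?trunc_log_ltn //; lia.
have kB : k.-1 <= kappa by rewrite /kappa leq_pmulr.
have B0 : 0 < B by rewrite BE addn1.
case: (boolP ((t ^ 3 <= N) && (18 * t ^ 2 <= M))) => [/andP[t3 t2]|big]; last first.
  have BX e : w <= B ^ e.+1.
    by apply: (@leq_trans B); [rewrite BE; lia | rewrite expnS leq_pmulr // expn_gt0 B0].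
  (* If [t ^ 3 <= N], the failing condition is the other one, and then [N <= M < 18 * t ^ 2]. *)
  have Nt : N <= 18 * t ^ 3.
    case: (leqP (t ^ 3) N) big => [_|/ltnW le _] /=; last by lia.
    rewrite -ltnNge => lt; apply: (@leq_trans M).
      by rewrite /M -{1}[N]expn1 leq_pexp2l //; lia.
    by apply: leq_trans (ltnW lt) _; rewrite leq_mul2l /= leq_pexp2l.
  apply: exhaustive_structure leG _ _ => //.
    by rewrite mulnC; apply: leq_mul (leq_addr _ _); rewrite (leq_trans (BX 2)) // leq_pmull.
  by apply: leq_trans (leq_mul Nt (BX 3)) _; rewrite mulnAC leq_mul2r leq_mul2r orbT orbT.
set m := M %/ (18 * t ^ 2).
have m18 : 18 * m * t ^ 2 <= M by rewrite mulnAC mulnC; exact: leq_trunc_div.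
have m_pos : 0 < m by rewrite divn_gt0 // muln_gt0 expn_gt0 t0.
apply: (@table_structure k N' G w (6 * B ^ 2) _ _ m B t (72 * t) kappa kappa);
  rewrite -/N -/M //.
(* As [m] is positive, [m.+1 <= 2 * m], so [2 * M <= 72 * t ^ 2 * m]; this is the source of
   [q = 72 * t]. *)
- have : M < m.+1 * (18 * t ^ 2) by rewrite ltn_ceil // muln_gt0 expn_gt0 t0.
  by move: m_pos; nia.
- exact: ltnW.
- rewrite BE addn1 expnS mul2n -addnn leq_add //.
    apply: leq_trans (leq_div _ _) _; apply: leq_trans (ltnW MltK) _.
    by rewrite leq_exp2l // leq_addr.
  by apply: leq_trans leG _; rewrite leq_exp2l // leq_addl.
- by rewrite BE; apply: cell_bits => //; [exact: ltnW | exact: leq_div].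
(* Seeds take [O(B * N)] cells since [t ^ 2 <= N], and endpoints [O(B * (M / t))]. In all
   [78 * B * (N + M / t)] cells suffice, and [6 * B ^ 2] bits per cell give [468 * B ^ 3]. *)
- have e3 : 18 * t * m <= M %/ t by rewrite leq_divRL //; nia.
  have tN : t * t <= N by apply: leq_trans t3; rewrite mulnn leq_pexp2l.
  have kB' : kappa <= B by rewrite BE; lia.
  have h1 : 72 * t * kappa * t <= 72 * (B * N) by nia.
  have h2 : 72 * t * kappa * m <= 4 * (B * (M %/ t)) by nia.
  have h3 : N + M %/ t <= B * (N + M %/ t) by rewrite leq_pmull.
  have h4 : N + M %/ t + 72 * t * kappa * t + 72 * t * kappa * m <= 78 * (B * (N + M %/ t)).
    by rewrite mulnDr; rewrite mulnDr in h3; lia.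
  by apply: leq_trans (leq_mul h4 (leqnn _)) _; move: (N + M %/ t) => X; apply: eq_leq; ring.
(* At most [73 * t ^ 2 * B] attempts of at most [6 * t * B * L] probes, with [L = 6 * B ^ 2]; the
   constant is [73 * 6 * 6]. *)
- rewrite /query_cost; set L := 6 * B ^ 2.
  have kB' : kappa + 1 <= B by rewrite BE; lia.
  have c1 : (72 * t * kappa * t).+1 <= 73 * (t ^ 2 * B).
    have : t * kappa * t <= t ^ 2 * B by rewrite expnS expn1; nia.
    have : 0 < t ^ 2 * B by rewrite muln_gt0 expn_gt0 t0.
    by nia.
  have c2 : L + (k.-1 * L + kappa.+1 * L) <= 2 * B * L.
    by rewrite -!mulnDl -mulSn leq_mul2r; apply/orP; right; lia.
  have c3 : kappa.+2 * L + k.-1 * L <= 2 * B * L.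
    by rewrite -!mulnDl leq_mul2r; apply/orP; right; lia.
  have c4 : 2 * (t * (L + (k.-1 * L + kappa.+1 * L))) + (kappa.+2 * L + k.-1 * L) <= 6 * (t * B * L).
    have := leq_mul (leqnn t) c2; have : B * L <= t * (B * L) by rewrite leq_pmull.
    by nia.
  apply: leq_trans (leq_mul c1 c4) _; rewrite /L.
  by apply: eq_leq; ring.
Qed.

(** * Asymptotics *)

From mathcomp Require Import all_classical all_reals all_analysis.
Import numFieldNormedType.Exports.

Local Open Scope classical_set_scope.
Local Open Scope ring_scope.

Lemma softO_of_le (R : realType) (f g B : nat -> R) (a : R) (e : nat) :
  (forall N, (0 < N)%N -> 0 <= f N <= a * B N ^+ e * g N) -> 0 <= a ->
  (forall N, 0 <= B N) -> (forall N, 0 <= g N) ->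
  (B : nat -> R^o) =O_\oo (fun N => ln (N%:R : R) : R^o) -> softO f g.
Proof.
move=> fle a0 B0 g0 /eqO_exP[C C0 BC]; exists e; apply/eqO_exP.
(* The added 1 keeps the constant positive when [a] is zero. *)
exists (a * C ^+ e + 1); first by rewrite ltr_wpDl // mulr_ge0 // exprn_ge0 // ltW.
near=> N.
have N0 : (0 < N)%N by near: N; exact: nbhs_infty_gt.
have lnN : 0 <= ln N%:R :> R by rewrite ln_ge0 // ler1n.
have BCN : `|B N| <= C * `|ln N%:R| by near: N; exact: BC.
have /andP[f0 {}fle] := fle N N0.
rewrite ger0_norm // ger0_norm ?mulr_ge0 ?exprn_ge0 //.
rewrite !ger0_norm // in BCN.
apply: (le_trans fle); rewrite mulrDl mul1r -[leLHS]addr0 lerD ?mulr_ge0 ?exprn_ge0 //.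
have -> : a * C ^+ e * (g N * ln N%:R ^+ e) = a * (C * ln N%:R) ^+ e * g N.
  by rewrite exprMn; ring.
by rewrite ler_wpM2r // ler_wpM2l // lerXn2r // nnegrE ?mulr_ge0 // ltW.
Unshelve. all: by end_near.
Qed.

Lemma bit_budget_bigO (R : realType) (k : nat) (w : nat -> nat) :
  (fun N => (w N)%:R : R^o) =O_\oo (fun N => ln (N%:R : R) : R^o) ->
  (fun N => (bit_budget k (w N) N)%:R : R^o) =O_\oo (fun N => ln (N%:R : R) : R^o).
Proof.
move=> /eqO_exP[C C0 wC]; apply/eqO_exP.
have ln2 : 0 < ln 2 :> R by rewrite ln_gt0 // ltr1n.
(* For [N >= 2] both [trunc_log 2 N] and 1 are at most [ln N / ln 2], which explains the factor 2
   and the last summand. *)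
exists (k%:R * (2 / ln 2) + C + 1 / ln 2).
  by rewrite addr_gt0 ?divr_gt0 // ltr_wpDl // mulr_ge0 // divr_ge0 // ltW.
near=> N.
have N2 : (1 < N)%N by near: N; exact: nbhs_infty_gt.
have lnN : ln 2 <= ln N%:R :> R by rewrite ler_ln ?posrE ?ltr0n ?ler_nat // (ltnW N2).
have lnN0 : 0 <= ln N%:R :> R by apply: le_trans lnN; exact: ltW.
have wCN : `|(w N)%:R| <= C * `|ln N%:R| by near: N; exact: wC.
rewrite !ger0_norm // in wCN *; rewrite /bit_budget !natrD natrM.
rewrite [leRHS]mulrDl [X in _ <= X + _]mulrDl !lerD //.
  rewrite -mulrA; apply: ler_pM => //; first by rewrite ler_nat leq_pred.
  rewrite mulrAC ler_pdivlMr // -natr1 mulrDl mul1r.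
  have : (trunc_log 2 N)%:R * ln 2 <= ln N%:R :> R.
    rewrite mulr_natl -lnXn // ler_ln ?posrE ?exprn_gt0 ?ltr0n ?(ltnW N2) //.
    by rewrite -natrX ler_nat trunc_logP // ltnW.
  lra.
by rewrite mulrAC mul1r ler_pdivlMr // mul1r.
Unshelve. all: by end_near.
Qed.

Theorem theorem3p3 (R : realType) (k : nat) (hk : (3 <= k)%N)
    (delta : R) (hdelta0 : 0 <= delta) (hdelta : delta <= k%:R - 2)
    (c : R) (hc : 0 < c)
    (w : nat -> nat)
    (hw : (fun N => (w N)%:R : R^o) =Theta_\oo (fun N => ln (N%:R : R) : R^o))
    (hfit : forall N : nat, (k.-1 <= N)%N -> N%:R `^ c <= (2 ^ w N)%:R :> R) :
  exists S T : nat -> nat,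
    [/\ softO (fun N => (S N)%:R) (fun N => N%:R `^ (k%:R - 1 - delta) : R),
        softO (fun N => (T N)%:R) (fun N => N%:R `^ (3 * delta) : R) &
        forall (N : nat) (G : finZmodType) (Index : G -> nat),
          (k.-1 <= N)%N ->
          #|G|%:R <= N%:R `^ c :> R ->
          injective Index ->
          (forall g : G, (1 <= Index g)%N /\ (Index g)%:R <= N%:R `^ c :> R) ->
          exists P : data_structure G N (w N) (S N),
            solves_kSUM_indexing k (T N) P].
Proof.
(* Then [N ^ delta <= t <= 2 * N ^ delta] for positive [N]: the lower bound serves the space, the
   upper bound the time. *)
pose t N := (Num.truncn (N%:R `^ delta : R)).+1.
pose B N := bit_budget k (w N) N.
have BO : (fun N => (B N)%:R : R^o) =O_\oo (fun N => ln (N%:R : R) : R^o).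
  by apply: bit_budget_bigO; move: hw; rewrite eqThetaE bigThetaE => -[].
have t_gt N : N%:R `^ delta <= (t N)%:R.
  exact/ltW/truncnS_gt.
have t_le N : (0 < N)%N -> (t N)%:R <= 2 * N%:R `^ delta.
  move=> N0; rewrite /t -natr1 mulr_natl mulr2n lerD //.
    by rewrite truncn_le // powR_ge0.
  by rewrite -[leLHS](powRr0 N%:R) ler_powR // ler1n.
have [c1 [c2 struct]] : exists c1 c2, forall N (G : finZmodType), (0 < N)%N -> (0 < w N)%N ->
    (#|G| <= 2 ^ w N)%N ->
    exists P : data_structure G N (w N) (c1 * B N ^ 3 * (N + N ^ k.-1 %/ t N)),
      solves_kSUM_indexing k (c2 * B N ^ 4 * t N ^ 3) P.
  by exists 468%N, 2628%N => N G N0 w0 leG; exact: kSUM_structure.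
exists (fun N => c1 * B N ^ 3 * (N + N ^ k.-1 %/ t N))%N.
exists (fun N => c2 * B N ^ 4 * t N ^ 3)%N; split.
- apply: (softO_of_le (a := c1%:R * 2) (e := 3) _ _ _ _ BO) => [N N0||N|N].
  + rewrite ler0n /= 2!natrM natrX natrD.
    rewrite [c1%:R * 2 * _]mulrAC -[leRHS]mulrA ler_wpM2l ?mulr_ge0 ?exprn_ge0 //.
    (* One copy of the target absorbs [N], because [delta <= k - 2] makes its exponent at least 1;
       the other absorbs [N ^ k.-1 %/ t N]. *)
    rewrite mulr_natl mulr2n lerD //.
      by rewrite -[leLHS]powRr1 // ler_powR ?ler1n //; lra.
    have N0' : 0 < N%:R :> R by rewrite ltr0n.
    rewrite powRB ?(gt_eqF N0') ?implybT //.
    have -> : N%:R `^ (k%:R - 1) = (N ^ k.-1)%:R :> R.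
      rewrite natrX -powR_mulrn //; congr (_ `^ _).
      by rewrite -[in LHS](ltn_predK hk) -natr1 addrK.
    rewrite ler_pdivlMr ?powR_gt0 //.
    apply: (@le_trans _ _ ((N ^ k.-1 %/ t N)%:R * (t N)%:R)); first by rewrite ler_wpM2l.
    by rewrite -natrM ler_nat leq_trunc_div.
  + by rewrite mulr_ge0.
  + exact: ler0n.
  + exact: powR_ge0.
- apply: (softO_of_le (a := c2%:R * 8) (e := 4) _ _ _ _ BO) => [N N0||N|N].
  + rewrite ler0n /= 2!natrM !natrX.
    rewrite [c2%:R * 8 * _]mulrAC -[leRHS]mulrA ler_wpM2l ?mulr_ge0 ?exprn_ge0 //.
    have -> : 8 * N%:R `^ (3 * delta) = (2 * N%:R `^ delta) ^+ 3 :> R.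
      rewrite exprMn -natrX; congr (_ * _).
      by rewrite mulrC powRrM powR_mulrn // powR_ge0.
    by rewrite lerXn2r ?nnegrE ?mulr_ge0 ?powR_ge0 // t_le.
  + by rewrite mulr_ge0.
  + exact: ler0n.
  + exact: powR_ge0.
move=> N G Index kN leG _ _.
have N2 : (1 < N)%N by apply: leq_trans kN; case: (k) hk => [|[|[|]]].
have leGw : (#|G| <= 2 ^ w N)%N by rewrite -(ler_nat R) (le_trans leG) // hfit.
(* Words of zero bits would force [N ^ c <= 1], against [N >= 2] and [c > 0]. *)
have w0 : (0 < w N)%N.
  have := hfit N kN; rewrite lt0n; case: eqP => // ->; rewrite expn0 leNgt => /negP[].
  have : 1 `^ c < N%:R `^ c :> R by rewrite gt0_ltr_powR ?nnegrE ?ltr1n.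
  by rewrite powR1.
by apply: struct => //; exact: ltnW.
Qed.
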